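(* Let $k\ge 3$ be an integer and let $L_k=\lim_{n\to\infty}R_n(k)^{1/n}\in(0,\infty]$. Then: (a) for every positive integer $n_0$, $R_{n_0}(k)^{1/n_0} < L_k$; (b) letting $S_k=\sup\{c(G) : G \text{ a finite graph with } \alpha(G)=k-1\}\in(0,\infty]$, for every finite graph $G$ with $\alpha(G)=k-1$ and every positive integer $n$ we have $\alpha(G^n)^{1/n}<S_k$; that is, the supremum of the Shannon capacity over graphs of independence number $k-1$ is not achieved by any finite graph power.
   Context: For integers $n\ge1$, $R_n(k)$ denotes the least $s>0$ such that every assignment of one of $n$ colors to each edge of the complete graph $K_s$ contains a complete subgraph $K_k$ all of whose edges have the same color. It is known that $\lim_{n\to\infty}R_n(k)^{1/n}$ exists, possibly infinite. Graphs are finite, simple, undirected and loopless; $\alpha(G)$ is the maximum size of a set of pairwise non-adjacent vertices. For graphs $G_1=(V_1,E_1),\dots,G_n=(V_n,E_n)$, the product $G_1\times\cdots\times G_n$ is the graph on $V_1\times\cdots\times V_n$ in which distinct vertices $(u_1,\dots,u_n),(v_1,\dots,v_n)$ are adjacent iff for every $i$, $u_i=v_i$ or $\{u_i,v_i\}\in E_i$; $G^n$ is the $n$-fold product of $G$ with itself. The Shannon capacity is $c(G)=\lim_{n\to\infty}\alpha(G^n)^{1/n}$. *)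

(* Defs.v *)
From mathcomp Require Import all_boot all_order all_algebra.

Set Implicit Arguments.
Unset Strict Implicit.
Unset Printing Implicit Defensive.

(* The edges of the complete graph K_s on the vertex set 'I_s. *)
Definition Kedge (s : nat) := {e : {set 'I_s} | #|e| == 2}.

Definition monochromatic (n s : nat) (c : {ffun Kedge s -> 'I_n})
    (A : {set 'I_s}) : bool :=
  [forall e : Kedge s, forall f : Kedge s,
    (val e \subset A) ==> (val f \subset A) ==> (c e == c f)].

Definition arrows (n k s : nat) : bool :=
  [forall c : {ffun Kedge s -> 'I_n},
    [exists A : {set 'I_s}, (#|A| == k) && monochromatic c A]].

Lemma ramsey_sets (n m : nat) (f : 'I_n.+1 -> nat) : \sum_i f i = m ->
  exists N, forall (T : finType) (C : {set T} -> 'I_n.+1) (V : {set T}),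
    N <= #|V| -> exists i (A : {set T}), [/\ A \subset V, #|A| = f i &
      forall x y, x \in A -> y \in A -> x != y -> C [set x; y] = i].
Proof.
elim: m f => [|m IHm] f sum_f.
  exists 0 => T C V _; exists ord0, set0; split; first exact: sub0set.
    move/eqP: sum_f; rewrite sum_nat_eq0 => /forallP /(_ ord0) /eqP ->.
    by rewrite cards0.
  by move=> x y; rewrite inE.
have [/existsP[i0 /eqP fi0]|/existsPn fpos] := boolP [exists i, f i == 0].
  exists 0 => T C V _; exists i0, set0; split; first exact: sub0set.
    by rewrite cards0 fi0.
  by move=> x y; rewrite inE.
have fgt0 i : 0 < f i by rewrite lt0n.
pose g i j := if j == i then (f j).-1 else f j.
have sum_g i : \sum_j g i j = m.
  apply: succn_inj; rewrite -sum_f (bigD1 i) //= [in RHS](bigD1 i) //=.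
  rewrite /g eqxx -addSn prednK //; congr addn.
  by apply: eq_bigr => j /negbTE ->.
have /fin_all_exists[N HN] i := IHm (g i) (sum_g i).
exists (\sum_i N i).+1 => T C V leV.
have /card_gt0P[v vV] : 0 < #|V| by exact: leq_trans leV.
pose W i := [set x in V :\ v | C [set v; x] == i].
have sumW : \sum_i #|W i| = #|V :\ v|.
  rewrite -sum1_card (partition_big (fun x => C [set v; x]) xpredT) //=.
  by apply: eq_bigr => i _; rewrite -sum1_card; apply: eq_bigl => x; rewrite !inE.
have [i leW] : exists i, N i <= #|W i|.
  apply/existsP; apply: contraT; rewrite negb_exists => /forallP ltW.
  have : \sum_i #|W i| < \sum_i N i.
    rewrite (bigD1 ord0) //= [X in _ < X](bigD1 ord0) //= -addSn.
    apply: leq_add; first by rewrite ltnNge ltW.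
    by apply: leq_sum => i _; rewrite ltnW // ltnNge ltW.
  by rewrite sumW; move: leV; rewrite (cardsD1 v V) vV add1n ltnS leqNgt => /negbTE ->.
have [j [A [AW cA monoA]]] := HN i T C (W i) leW.
have AV : A \subset V.
  by apply: subset_trans AW _; apply/subsetP => x; rewrite !inE => /andP[/andP[]].
have [ji|neqji] := eqVneq j i; last first.
  by exists j, A; split=> //; rewrite cA /g (negbTE neqji).
exists i, (v |: A); have vA : v \notin A.
  by apply/negP => /(subsetP AW); rewrite !inE eqxx.
split; first by rewrite subUset sub1set vV.
  by rewrite cardsU1 vA cA /g ji eqxx add1n prednK.
have Cv x : x \in A -> C [set v; x] = i.
  by move=> /(subsetP AW); rewrite !inE => /andP[_ /eqP].
move=> x y /setU1P[->|xA] /setU1P[->|yA] nxy; first by rewrite eqxx in nxy.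
- exact: Cv.
- by rewrite setUC Cv.
- by rewrite -ji monoA.
Qed.

Lemma ramsey_exists (n k : nat) : exists s, (0 < s) && arrows n k s.
Proof.
case: n => [|n].
  exists 2; apply/andP; split=> //; apply/forallP => c.
  have e2 : #|[set: 'I_2]| == 2 by rewrite cardsT card_ord.
  by case: (c (exist _ [set: 'I_2] e2)).
have [N HN] := @ramsey_sets n _ (fun=> k) erefl.
exists N.+1; apply/andP; split=> //; apply/forallP => c.
pose C (e : {set 'I_N.+1}) := if insub e is Some e' then c e' else ord0.
have [|i [A [_ cA monoA]]] := HN _ C [set: 'I_N.+1].
  by rewrite cardsT card_ord.
have ci (e : Kedge N.+1) : val e \subset A -> c e = i.
  move=> eA; have /cards2P[x [y [nxy exy]]] : #|val e| == 2 := valP e.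
  have xA : x \in A by apply: (subsetP eA); rewrite exy !inE eqxx.
  have yA : y \in A by apply: (subsetP eA); rewrite exy !inE eqxx orbT.
  by rewrite -(monoA x y) // -exy /C valK.
apply/existsP; exists A; rewrite cA eqxx /=.
apply/forallP => e; apply/forallP => f.
by apply/implyP => /ci ->; apply/implyP => /ci ->.
Qed.

(* [ramsey n k] is R_n(k): the number of colors comes first. *)
Definition ramsey (n k : nat) : nat := ex_minn (ramsey_exists n k).

Record sgraph := SGraph {
  vertex :> finType;
  adj : rel vertex;
  adj_sym : symmetric adj;
  adj_irrefl : irreflexive adj }.

Definition independent (G : sgraph) (A : {set G}) : bool :=
  [forall x in A, forall y in A, ~~ adj x y].

Definition alpha (G : sgraph) : nat :=
  \max_(A : {set G} | independent A) #|A|.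

Section Product.
Variables (n : nat) (G : 'I_n -> sgraph).

Definition prod_adj : rel {dffun forall i : 'I_n, G i} :=
  fun u v => (u != v) && [forall i, (u i == v i) || adj (u i) (v i)].

Lemma prod_adj_sym : symmetric prod_adj.
Proof.
move=> u v; rewrite /prod_adj eq_sym; congr andb.
by apply: eq_forallb => i; rewrite eq_sym adj_sym.
Qed.

Lemma prod_adj_irrefl : irreflexive prod_adj.
Proof. by move=> u; rewrite /prod_adj eqxx. Qed.

Definition graph_prod : sgraph := SGraph prod_adj_sym prod_adj_irrefl.
End Product.

Definition graph_pow (G : sgraph) (n : nat) : sgraph :=
  graph_prod (fun _ : 'I_n => G).

From mathcomp Require Import all_classical all_reals all_analysis.

Import Order.TTheory GRing.Theory Num.Theory.
Import numFieldNormedType.Exports.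

Local Open Scope classical_set_scope.
Local Open Scope ring_scope.

(* [nthroot R n m] is m^(1/n). *)
Definition nthroot (R : realType) (n m : nat) : R := m%:R `^ n%:R^-1.

Definition ramsey_lim (R : realType) (k : nat) : \bar R :=
  limn (fun n => (nthroot R n (ramsey n k))%:E).

Definition shannon_capacity (R : realType) (G : sgraph) : R :=
  limn (fun n => nthroot R n (alpha (graph_pow G n))).

Definition shannon_sup (R : realType) (k : nat) : \bar R :=
  ereal_sup [set x | exists2 G : sgraph,
    alpha G = (k - 1)%N & x = (shannon_capacity R G)%:E].

(* Main.v *)
(* Write r_n = R_n(k) - 1 for the largest order of a complete graph having an
   n-colouring without monochromatic K_k. Lexicographic products make r_n
   supermultiplicative, so Fekete's lemma gives L_k = sup_m r_m^(1/m). The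
   coordinates of a non-adjacent pair colour an independent set of G^n, hence
   alpha(G^n) <= r_n; conversely the join of the complements of the m colour
   classes has an m-th power with a diagonal independent set of size r_m, hence
   S_k >= sup_m r_m^(1/m). Both parts thus reduce to finding, for each n, some m
   with r_m^(1/m) > R_n(k)^(1/n) = (r_n + 1)^(1/n).

   Products only give r_n^(1/n). To do better, let C0 be an optimal n-colouring
   of r = r_n letters and build colourings X_t with t n colours: X_(t+1) is the
   product of X_t and C0, pairs with distinct letters receiving new colours,
   except that in a sparse family of layers {p} x letters some new colours are
   replaced by old ones which do not occur between layers of the family. Such
   a layer then leaves room for additional points joined to it by new colours.
   The orders satisfy a_(t+1) = r a_t + (r + 3) a_(t-1), and the dominant root
   of x^2 = r x + (r + 3) is larger than r + 1.

   This needs n >= 2 and r not too small. The case n = 1 and the case k = 3,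
   n = 2 follow from colourings of the differences |x - y| in the style of
   Schur: these give L_k >= 2 k - 3, and L_3 >= 89^(1/4) > 3. *)

Require Import Defs.
From mathcomp Require Import all_boot zify.

Set Implicit Arguments.
Unset Strict Implicit.
Unset Printing Implicit Defensive.

(** * Colourings of pairs and their monochromatic cliques *)

Definition mono_on (T : finType) (P : Type) (C : T -> T -> P) (c : P)
    (A : {set T}) :=
  {in A &, forall x y, x != y -> C x y = c}.

Definition clique_free (k : nat) (T : finType) (P : Type) (C : T -> T -> P) :=
  forall c (A : {set T}), mono_on C c A -> #|A| < k.

(** The hypothesis makes [phi] injective on [A], so its image is a clique of the same size; most
    clique bounds below consist in choosing [phi]. *)
Lemma clique_free_map k (S T : finType) (P : Type) (C : T -> T -> P) (c : P)
    (phi : S -> T) (A : {set S}) :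
  clique_free k C ->
  {in A &, forall x y, x != y ->
     phi x != phi y /\ C (phi x) (phi y) = c} ->
  #|A| < k.
Proof.
move=> kC phiP; have phi_inj : {in A &, injective phi}.
  by move=> x y xA yA exy; apply/eqP/negP => /negP /(phiP _ _ xA yA)[]; rewrite exy eqxx.
rewrite -(card_in_imset phi_inj); apply: (kC c).
move=> _ _ /imsetP[x xA ->] /imsetP[y yA ->] neq.
by apply: (proj2 (phiP _ _ xA yA _)); apply: contraNneq neq => ->.
Qed.

Lemma card_lt_of_pair k (T : finType) (A : {set T}) (a b : T) : 2 < k ->
  (forall t, t \in A -> t != a -> t != b -> False) -> #|A| < k.
Proof.
move=> k2 H; apply: leq_ltn_trans k2.
have /subset_leq_card : A \subset [set a; b].
  apply/subsetP => t tA; rewrite !inE; case: eqP => //= /eqP na.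
  by case: eqP => //= /eqP nb; case: (H t).
by move/leq_trans; apply; rewrite cards2; case: (_ == _).
Qed.

(** * Extending a colouring by one level *)

Section Step.
Variables (k : nat) (T0 P0 : finType) (C0 : T0 -> T0 -> P0).
Hypotheses (k_gt2 : 2 < k) (C0_sym : forall x y, C0 x y = C0 y x)
  (C0_free : clique_free k C0).
(** Six distinct letters: an isosceles triangle [o] whose equal sides have colour [c1], and a
    triangle [z true], [z false], [w] avoiding [c1]. The colour [kappa] is absent from the triangle
    [o]. *)
Variables (o : option bool -> T0) (z : bool -> T0) (w : T0) (c1 kappa : P0).
Hypotheses (o_inj : injective o) (z_inj : injective z).
Hypotheses (o_z : forall i b, o i != z b) (o_w : forall i, o i != w)
  (z_w : forall b, z b != w).
Hypotheses (C_o1 : forall j, C0 (o None) (o (Some j)) = c1)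
  (C_zz : forall b b', b != b' -> C0 (z b) (z b') != c1)
  (C_zw : forall b, C0 (z b) w != c1).
Hypotheses (kappa1 : kappa != c1)
  (kappa2 : forall j j', j != j' -> C0 (o (Some j)) (o (Some j')) != kappa).

(* [X] is the colouring to be extended and [K] embeds the palette of its last
   level. Each [e : Y] has three special layers [h e i], coloured among
   themselves like the letters [o i]; special layers over distinct [e] never
   see a colour of [K], which is what frees [K] for reuse inside layers. *)
Variables (TX PX Y : finType) (X : TX -> TX -> PX) (K : P0 -> PX)
  (h : Y -> option bool -> TX).
Hypotheses (X_sym : forall x y, X x y = X y x) (X_free : clique_free k X).
Hypotheses (K_inj : injective K)
  (h_inj : forall e e' i i', h e i = h e' i' -> e = e' /\ i = i')
  (X_far : forall e e' i i' c, e != e' -> X (h e i) (h e' i') != K c)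
  (X_near : forall e i i', i != i' -> X (h e i) (h e i') = K (C0 (o i) (o i'))).

Let isF (p : TX) := [exists e, p == h e None].
Let isG (p : TX) := [exists e, exists j, p == h e (Some j)].
Let inQ (x : T0) := (x == z true) || (x == z false).
Let inO (x : T0) := [exists i, x == o i].

(* Pairs between the layers [h e None] and [h e (Some j)] which keep their old
   colour although their letters differ. *)
Let strick (p : TX) (x : T0) (q : TX) (y : T0) :=
  [&& [exists e, (p == h e None) && [exists j, q == h e (Some j)]], inQ x
    & C0 x y != c1].

(* Besides the product [TX * T0] there are two kinds of additional points:
   [(e, l)] with [l != w], a copy of the letters which sees the outside like the
   layer [h e None]; and [(e, j, b)], a twin of the letter [z b] in the layer
   [h e (Some j)]. Colours are [inl] (old) or [inr] (new). *)
Definition step_point : finType :=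
  ((TX * T0) + ((Y * {l : T0 | l != w}) + (Y * bool * bool)))%type.

(** A layer [h e None] returns entirely to old colours, which frees the new ones for the points
    [(e, l)]. A layer [h e (Some j)] gives up only the [c1] pairs meeting a letter [z b], which
    frees [c1] for the twins. The last exception keeps the letters [o i] of different layers on old
    colours, as the next level requires. *)
Definition step_EE (p : TX) (x : T0) (q : TX) (y : T0) : PX + P0 :=
  if p == q then
    if isF p then inl (K (C0 x y))
    else if [&& isG p, C0 x y == c1 & inQ x || inQ y] then inl (K kappa)
    else inr (C0 x y)
  else if [|| x == y, strick p x q y, strick q y p x
            | [&& inO x, inO y, ~~ isF p & ~~ isF q]] then inl (X p q)
  else inr (C0 x y).

(** The whole layer [h e None] looks like the single letter [w], hence the condition [l != w]. *)
Definition step_VE (e : Y) (l : T0) (q : TX) : PX + P0 :=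
  if q == h e None then inr (C0 l w) else inl (X (h e None) q).

Definition step_VV (e : Y) (l : T0) (e' : Y) (l' : T0) : PX + P0 :=
  if e == e' then inr (C0 l l') else inl (X (h e None) (h e' None)).

Definition step_QE (e : Y) (j b : bool) (q : TX) (y : T0) : PX + P0 :=
  if q == h e (Some j) then inr (if y == z b then c1 else C0 (z b) y)
  else if q == h e None then
    if inQ y then inr (C0 (z b) w)
    else if C0 (z b) y == c1 then inl (X (h e (Some j)) q)
    else inr (C0 (z b) y)
  else inl (X (h e (Some j)) q).

Definition step_QQ (e : Y) (j b : bool) (e' : Y) (j' b' : bool) : PX + P0 :=
  if e == e' then inr (if b == b' then c1 else C0 (z b) (z b'))
  else inl (X (h e (Some j)) (h e' (Some j'))).

Definition step_color (s t : step_point) : PX + P0 :=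
  match s, t with
  | inl (p, x), inl (q, y) => step_EE p x q y
  | inl (q, _), inr (inl (e, l)) => step_VE e (val l) q
  | inr (inl (e, l)), inl (q, _) => step_VE e (val l) q
  | inl (q, y), inr (inr (e, j, b)) => step_QE e j b q y
  | inr (inr (e, j, b)), inl (q, y) => step_QE e j b q y
  | inr (inl (e, l)), inr (inl (e', l')) => step_VV e (val l) e' (val l')
  | inr (inl (e, _)), inr (inr (e', j, _)) => inl (X (h e None) (h e' (Some j)))
  | inr (inr (e', j, _)), inr (inl (e, _)) => inl (X (h e None) (h e' (Some j)))
  | inr (inr (e, j, b)), inr (inr (e', j', b')) => step_QQ e j b e' j' b'
  end.

Lemma step_color_sym s t : step_color s t = step_color t s.
Proof.
case: s t => [[p x]|[[e l]|[[e j] b]]] [[q y]|[[e' l']|[[e' j'] b']]] //=.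
- rewrite /step_EE eq_sym; case: eqP => [->|_]; first by rewrite C0_sym orbC.
  rewrite (eq_sym x y) X_sym C0_sym; case: (y == x) => //=.
  rewrite [inO x && _]andbCA; congr (if _ then _ else _).
  rewrite !orbA [strick p x q y || _]orbC; congr (_ || _).
  by congr andb; congr andb; rewrite andbC.
- by rewrite /step_VV eq_sym C0_sym X_sym.
- by rewrite /step_QQ (eq_sym e) (eq_sym b) C0_sym X_sym.
Qed.

Let base (s : step_point) : TX :=
  match s with
  | inl (p, _) => p
  | inr (inl (e, _)) => h e None
  | inr (inr (e, j, _)) => h e (Some j)
  end.

(* Hence an old clique with injective [base] is a clique of [X], and any other
   one has two points in the same special layer. *)
Lemma step_old_base s t c : base s != base t -> step_color s t = inl c ->
  X (base s) (base t) = c.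
Proof.
case: s t => [[p x]|[[e l]|[[e j] b]]] [[q y]|[[e' l']|[[e' j'] b']]] //=.
- by rewrite /step_EE => /negbTE ->; case: ifP => // _ [].
- by rewrite /step_VE => /negbTE ->; rewrite X_sym => -[].
- rewrite /step_QE => /negbTE ->; rewrite [X p _]X_sym.
  by do ?[case: ifP => _]; case.
- by rewrite /step_VE eq_sym => /negbTE -> [].
- by rewrite /step_VV; case: (e == e') => // _ [].
- by move=> _ [].
- rewrite /step_QE eq_sym => /negbTE ->.
  by do ?[case: ifP => _]; case.
- by rewrite X_sym => _ [].
- by rewrite /step_QQ; case: (e == e') => // _ [].
Qed.

Let inQP x : inQ x -> exists b, x = z b.
Proof. by case/orP => /eqP ->; [exists true|exists false]. Qed.

Let inQz b : inQ (z b).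
Proof. by rewrite /inQ; case: b; rewrite eqxx ?orbT. Qed.

Let inQ_c1 x y : inQ x -> inQ y -> x != y -> C0 x y != c1.
Proof.
move=> /inQP[b ->] /inQP[b' ->] ne; apply: C_zz.
by apply: contraNneq ne => ->.
Qed.

Let inO_inQ x : inO x -> inQ x = false.
Proof.
case/existsP => i /eqP ->; apply/negP => /inQP[b] /eqP.
by rewrite (negbTE (o_z i b)).
Qed.

Let hF_isF e : isF (h e None).
Proof. by apply/existsP; exists e. Qed.

Let hG_isF e j : isF (h e (Some j)) = false.
Proof. by rewrite /isF; apply/existsP => -[e' /eqP /h_inj[]]. Qed.

Let hG_isG e j : isG (h e (Some j)).
Proof. by apply/existsP; exists e; apply/existsP; exists j. Qed.

Let hGF e e' j : (h e (Some j) == h e' None) = false.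
Proof. by apply/negP => /eqP /h_inj[]. Qed.

Let hFG e e' j : (h e None == h e' (Some j)) = false.
Proof. by apply/negP => /eqP /h_inj[]. Qed.

Let strickFG e j x y :
  strick (h e None) x (h e (Some j)) y = inQ x && (C0 x y != c1).
Proof.
rewrite /strick; suff -> : [exists e', (h e None == h e' None) &&
  [exists j', h e (Some j) == h e' (Some j')]] by [].
apply/existsP; exists e; rewrite eqxx /=; apply/existsP; exists j.
by rewrite eqxx.
Qed.

Let strickP p x q y : strick p x q y ->
  exists e j, [/\ p = h e None, q = h e (Some j), inQ x & C0 x y != c1].
Proof.
by case/and3P => /existsP[e /andP[/eqP -> /existsP[j /eqP ->]]]; exists e, j.
Qed.

(** * Cliques in a new colour *)

Let EE_new p x q y d : inl (p, x) != inl (q, y) :> step_point ->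
  step_EE p x q y = inr d -> x != y /\ C0 x y = d.
Proof.
rewrite /step_EE; case: (p =P q) => [->|_] neq.
  have nxy : x != y by apply: contraNneq neq => ->.
  by case: ifP => // _; case: ifP => // _ [].
by case: (x =P y) => [//|_] /=; case: ifP => // _ [].
Qed.

(** An additional point over [e0] sees new colours only towards points over or in the layers of
    [e0]. In every case the clique maps to a clique of [C0] or has at most two points. *)
Lemma step_new_clique d A : mono_on step_color (inr d) A -> #|A| < k.
Proof.
move=> monoA.
have [/existsP[e0 /existsP[l0 v0A]]|noV] :=
    boolP [exists e, exists l, inr (inl (e, l)) \in A].
  have mem s : s \in A ->
      (exists l, s = inr (inl (e0, l))) \/ (exists x, s = inl (h e0 None, x)).
    move=> sA; have [->|ne] := eqVneq s (inr (inl (e0, l0))); first by left; exists l0.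
    have := monoA _ _ sA v0A ne.
    case: s {sA ne} => [[p x]|[[e l]|[[e j] b]]] //=.
      by rewrite /step_VE; case: eqP => // -> _; right; exists x.
    by rewrite /step_VV; case: eqP => // -> _; left; exists l.
  (* Inside [h e0 None] all colours are old, so at most one of its points occurs; it plays the
     letter [w]. *)
  apply: (clique_free_map (phi := fun s => if s is inr (inl (_, l)) then val l else w)
    (c := d) C0_free) => s t sA tA ne.
  have := monoA _ _ sA tA ne.
  move: ne; case: (mem _ sA) => -[u ->]; case: (mem _ tA) => -[v ->] /=.
  - rewrite /step_VV eqxx => ne [<-]; split=> //.
    by apply: contraNneq ne => /val_inj ->.
  - by rewrite /step_VE eqxx => _ [<-]; split=> //; apply: (valP u).
  - rewrite /step_VE eqxx => _ [<-]; split; last by rewrite C0_sym.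
    by rewrite eq_sym; apply: (valP v).
  - by rewrite /step_EE eqxx hF_isF.
have nV e l : inr (inl (e, l)) \in A -> False.
  by move=> H; move/negP: noV; apply; apply/existsP; exists e; apply/existsP; exists l.
have [/existsP[e0 /existsP[j0 /existsP[b0 q0A]]]|noQ] :=
    boolP [exists e, exists j, exists b, inr (inr (e, j, b)) \in A]; last first.
  have nQ e j b : inr (inr (e, j, b)) \in A -> False.
    move=> H; move/negP: noQ; apply; apply/existsP; exists e.
    by apply/existsP; exists j; apply/existsP; exists b.
  apply: (clique_free_map (phi := fun s => if s is inl (_, x) then x else w)
    (c := d) C0_free) => -[[p x]|[[e l]|[[e j] b]]] t sA; try by [case: (nV _ _ sA)|case: (nQ _ _ _ sA)].
  case: t => [[q y]|[[e l]|[[e j] b]]] tA; try by [case: (nV _ _ tA)|case: (nQ _ _ _ tA)].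
  by move=> ne; have /(EE_new ne) := monoA _ _ sA tA ne.
have mem s : s \in A ->
    [\/ exists j b, s = inr (inr (e0, j, b)),
        exists y, s = inl (h e0 (Some j0), y) |
        exists x, s = inl (h e0 None, x)].
  move=> sA; have [->|ne] := eqVneq s (inr (inr (e0, j0, b0))).
    by apply: Or31; exists j0, b0.
  have := monoA _ _ sA q0A ne.
  case: s {ne} sA => [[p x]|[[e l]|[[e j] b]]] sA /=.
  - rewrite /step_QE; case: eqP => [-> _|_]; first by apply: Or32; exists x.
    by case: eqP => [-> _|//]; apply: Or33; exists x.
  - by case: (nV _ _ sA).
  - by rewrite /step_QQ; case: eqP => // -> _; apply: Or31; exists j, b.
have mem_g j b y : inr (inr (e0, j, b)) \in A -> inl (h e0 (Some j0), y) \in A ->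
    j = j0.
  move=> qA yA; have := monoA _ _ qA yA isT.
  rewrite /= /step_QE hGF; case: eqP => //.
  by move=> /h_inj[_ [->]].
have [dc1|nd] := eqVneq d c1.
  (* Two twins of [z b0] in different layers exclude a third point: no letter sees both in [c1], and
     [C_zz] rules out twins of the other letter. *)
  have [q1A|q1NA] := boolP (inr (inr (e0, ~~ j0, b0)) \in A).
    apply: (card_lt_of_pair (a := inr (inr (e0, j0, b0))) (b := inr (inr (e0, ~~ j0, b0)))) => // t tA n1 n2.
    move: (tA) n1 n2; case: (mem _ tA) => [[j [b ->]]|[y ->]|[x ->]] {}tA n1 n2.
    - have := monoA _ _ tA q0A n1; rewrite /= /step_QQ eqxx dc1 => -[].
      case: eqP => [eb _|/eqP nb /eqP]; last by rewrite (negbTE (C_zz nb)).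
      by move: n1 n2; rewrite eb; case: (j) (j0) => -[]; rewrite ?eqxx.
    - by have := mem_g _ _ _ q1A tA; case: (j0).
    - have := monoA _ _ tA q0A n1; rewrite /= /step_QE hFG eqxx dc1.
      case: ifP => _; first by case=> /eqP; rewrite (negbTE (C_zw _)).
      by case: eqP => // ne [].
  have mem2 s : s \in A -> s != inr (inr (e0, j0, b0)) ->
      exists2 y, s = inl (h e0 (Some j0), y) & y = z b0 \/ C0 (z b0) y = c1.
    move=> sA n1; have := monoA _ _ sA q0A n1; rewrite dc1.
    move: (sA) n1; case: (mem _ sA) => [[j [b ->]]|[y ->]|[x ->]] {}sA n1 /=.
    - rewrite /step_QQ eqxx => -[].
      case: eqP => [eb _|/eqP nb /eqP]; last by rewrite (negbTE (C_zz nb)).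
      move: sA q1NA n1; rewrite eb; case: (j) (j0) => -[] H; rewrite ?eqxx ?H //.
    - rewrite /step_QE eqxx => -[]; case: eqP => [-> _|_ cy]; last by exists y; [|right].
      by exists (z b0); [|left].
    - rewrite /step_QE hFG eqxx.
      case: ifP => _; first by case=> /eqP; rewrite (negbTE (C_zw _)).
      by case: eqP => // ne [].
  (* The letter [z b0] and its twin also exhaust the clique, since the [c1] pairs at [z b0] in this
     layer became [K kappa]. Without [z b0], the twin takes its place. *)
  have [zA|zNA] := boolP (inl (h e0 (Some j0), z b0) \in A).
    apply: (card_lt_of_pair (a := inr (inr (e0, j0, b0))) (b := inl (h e0 (Some j0), z b0))) => // t tA n1 n2.
    move: (tA) n2; case: (mem2 _ tA n1) => y -> [->|cy] {}tA; first by rewrite eqxx.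
    move=> n2; have := monoA _ _ tA zA n2; rewrite /= /step_EE eqxx hG_isF hG_isG.
    by rewrite C0_sym cy eqxx inQz orbT.
  apply: (clique_free_map (phi := fun s => if s is inl (_, x) then x else z b0)
    (c := d) C0_free) => s t sA tA ne; have := monoA _ _ sA tA ne.
  have [es|ns] := eqVneq s (inr (inr (e0, j0, b0))).
    have nt : t != inr (inr (e0, j0, b0)) by rewrite -es eq_sym.
    case: (mem2 _ tA nt) => y et [ey|cy]; first by move: zNA; rewrite -ey -et tA.
    rewrite es et /= cy dc1 => _; split=> //.
    by apply: contraNneq zNA => ->; rewrite -et.
  case: (mem2 _ sA ns) => x es [ex|cx]; first by move: zNA; rewrite -ex -es sA.
  have [et|nt] := eqVneq t (inr (inr (e0, j0, b0))).
    rewrite es et /= C0_sym cx dc1 => _; split=> //.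
    by apply: contraNneq zNA => <-; rewrite -es.
  case: (mem2 _ tA nt) => y et _.
  by rewrite es et; apply: EE_new; rewrite -es -et.
(* For [d != c1], a letter [z b] in the layer [h e0 None] stands for [w]: by [strick], its only new
   colour towards [h e0 (Some j0)] is [c1]. *)
pose phi (s : step_point) := match s with
  | inl (p, x) => if (p == h e0 None) && inQ x then w else x
  | inr (inr (_, _, b)) => z b
  | _ => w end.
suff half s t : s \in A -> t \in A -> s != t ->
    (if s is inr _ then true else if t is inr _ then false else
     if t is inl (p, _) then p == h e0 (Some j0) else false) ->
    phi s != phi t /\ C0 (phi s) (phi t) = d.
  apply: (clique_free_map (phi := phi) (c := d) C0_free) => s t sA tA ne.
  have swap : (phi t != phi s /\ C0 (phi t) (phi s) = d) ->
      phi s != phi t /\ C0 (phi s) (phi t) = d by rewrite eq_sym C0_sym.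
  have ne' : t != s by rewrite eq_sym.
  case: (mem _ sA) => [[j [b es]]|[y es]|[x es]].
  - by apply: half; rewrite // es.
  - by apply: swap; apply: half; rewrite // es eqxx; case: (t).
  - case: (mem _ tA) => [[j [b et]]|[y et]|[y et]].
    + by apply: swap; apply: half; rewrite // et.
    + by apply: half; rewrite // es et eqxx.
    + by have := monoA _ _ sA tA ne; rewrite es et /= /step_EE eqxx hF_isF.
move=> sA tA ne; have := monoA _ _ sA tA ne; move: (sA) (tA) ne.
case: (mem _ sA) => [[j [b ->]]|[y ->]|[x ->]] {}sA;
    case: (mem _ tA) => [[j' [b' ->]]|[y' ->]|[x' ->]] {}tA ne //=.
- rewrite /step_QQ eqxx => -[]; case: eqP => [_ /eqP|/eqP nb cd _].
    by rewrite eq_sym (negbTE nd).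
  by split=> //; apply: contraNneq nb => /z_inj ->.
- rewrite (mem_g _ _ _ sA tA) hGF /= /step_QE eqxx => -[].
  case: eqP => [_ /eqP|/eqP ny cd _]; first by rewrite eq_sym (negbTE nd).
  by rewrite eq_sym.
- rewrite eqxx /= /step_QE hFG eqxx; case: ifP => [Qx [cd] _|nQ]; first by split.
  case: ifP => // _ [cd] _; split=> //.
  by apply/negP => /eqP ez; rewrite -ez inQz in nQ.
- by move=> /(EE_new ne); rewrite !hGF.
- by rewrite hFG.
- rewrite hGF !eqxx /= => /[dup] cd /(EE_new ne)[nx ec] _.
  case: ifP => // Qx; move: cd; rewrite /step_EE hFG strickFG Qx ec nd /=.
  by rewrite orbT.
- by rewrite hFG.
Qed.

(** * Cliques in an old colour with two points in one layer *)

Let X_Fg e j : X (h e None) (h e (Some j)) = K c1.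
Proof. by rewrite X_near // C_o1. Qed.

Let X_gF e j : X (h e (Some j)) (h e None) = K c1.
Proof. by rewrite X_sym X_Fg. Qed.

Let kappa_c1 : K c1 = K kappa -> False.
Proof. by move/K_inj/eqP; rewrite eq_sym (negbTE kappa1). Qed.

Let X_farF e e' i i' c : e != e' -> X (h e i) (h e' i') = K c -> False.
Proof. by move=> ne /eqP; rewrite (negbTE (X_far _ _ _ ne)). Qed.

Let strick_X p x q y : strick p x q y -> X p q = K c1.
Proof. by case/strickP => e [j [-> -> _ _]]. Qed.

Let old_EE p x q y c : p != q -> step_EE p x q y = inl c ->
  [/\ X p q = c & [|| x == y, strick p x q y, strick q y p x
            | [&& inO x, inO y, ~~ isF p & ~~ isF q]]].
Proof. by rewrite /step_EE => /negbTE ->; case: ifP => // H [<-]. Qed.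

(** The colour lies in the range of [K], which excludes additional points over other [e'], and
    product points of other layers cannot see both [x] and [y] in it. There remain letters of the
    layer and, for [K c1], at most one twin, which maps to [z b]. *)
Lemma step_old_cliqueF e x y c A : mono_on step_color (inl c) A ->
  inl (h e None, x) \in A -> inl (h e None, y) \in A -> x != y -> #|A| < k.
Proof.
move=> monoA xA yA nxy.
have cE u v : inl (h e None, u) \in A -> inl (h e None, v) \in A -> u != v ->
    K (C0 u v) = c.
  move=> uA vA nuv.
  have ne : inl (h e None, u) != inl (h e None, v) :> step_point.
    by apply: contraNneq nuv => -[->].
  by have := monoA _ _ uA vA ne; rewrite /= /step_EE eqxx hF_isF => -[].
have cxy := cE _ _ xA yA nxy.
have mem s : s \in A -> (exists u, s = inl (h e None, u)) \/
   (exists j b, [/\ s = inr (inr (e, j, b)), C0 x y = c1 & forall u,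
       inl (h e None, u) \in A -> ~~ inQ u /\ C0 (z b) u = c1]).
  case: s => [[q v]|[[e' l]|[[e' j] b]]] sA.
  - have [->|nq] := eqVneq q (h e None); first by left; exists v.
    have nsF u : inl (h e None, u) != inl (q, v) :> step_point.
      by apply: contraNneq nq => -[->].
    have adj u : inl (h e None, u) \in A ->
        X (h e None) q = c /\ (u == v) || strick (h e None) u q v.
      move=> uA; have := monoA _ _ uA sA (nsF u).
      move=> /= /old_EE[|-> H]; first by rewrite eq_sym.
      split=> //; case/or4P: H => [->|->|/strickP[e' [j [_ /eqP]]]|]; rewrite ?orbT //.
        by rewrite hFG.
      by rewrite hF_isF !andbF.
    have [Xq Hx] := adj x xA; have [_ Hy] := adj y yA.
    have Sfalse : strick (h e None) x q v \/ strick (h e None) y q v -> C0 x y = c1.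
      by case=> /strick_X; rewrite Xq -cxy => /K_inj.
    case/orP: Hx => [/eqP xv|sx].
      case/orP: Hy => [/eqP yv|sy]; first by rewrite xv yv eqxx in nxy.
      have c1E := Sfalse (or_intror sy).
      by case/strickP: sy => e' [j [_ _ _]]; rewrite -xv C0_sym c1E eqxx.
    have c1E := Sfalse (or_introl sx).
    case/orP: Hy => [/eqP yv|sy].
      by case/strickP: sx => e' [j [_ _ _]]; rewrite -yv c1E eqxx.
    case/strickP: sx => _ [_ [_ _ Qx _]]; case/strickP: sy => _ [_ [_ _ Qy _]].
    by have := inQ_c1 Qx Qy nxy; rewrite c1E eqxx.
  - have := monoA _ _ sA xA isT; rewrite /= /step_VE; case: eqP => // nq [Xc].
    case: (X_farF (e := e') (e' := e) (i := None) (i' := None) (c := C0 x y)).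
      by apply/eqP => ee; apply: nq; rewrite ee.
    by rewrite Xc cxy.
  - right; exists j, b.
    have ee : e' = e.
      have := monoA _ _ sA xA isT; rewrite /= /step_QE hFG.
      case: eqP => [/h_inj[] //|nq [Xc]].
      case: (X_farF (e := e') (e' := e) (i := Some j) (i' := None) (c := C0 x y)).
        by apply/eqP => ee; apply: nq; rewrite ee.
      by rewrite Xc cxy.
    move: sA; rewrite ee => sA.
    have adj u : inl (h e None, u) \in A -> [/\ ~~ inQ u, C0 (z b) u = c1 & K c1 = c].
      move=> uA; have := monoA _ _ sA uA isT.
      rewrite /= /step_QE hFG eqxx X_gF; case: (inQ u) => //.
      by case: eqP => // -> [].
    split=> //; last by move=> u /adj[].
    by case: (adj _ xA) => _ _; rewrite -cxy => /K_inj.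
pose phi (s : step_point) := match s with
  | inl (p, u) => u
  | inr (inr (_, _, b)) => z b
  | _ => w end.
apply: (clique_free_map (phi := phi) (c := C0 x y) C0_free) => s t sA tA ne.
have := monoA _ _ sA tA ne; move: (sA) (tA) ne.
case: (mem _ sA) => [[u ->]|[j [b [-> c1E Hb]]]] {}sA;
    case: (mem _ tA) => [[v ->]|[j' [b' [-> c1E' Hb']]]] {}tA ne /=.
- have nuv : u != v by apply: contraNneq ne => ->.
  by move=> _; split=> //; apply: K_inj; rewrite cxy; apply: cE.
- move=> _; have [nQ cu] := Hb' _ sA; rewrite C0_sym cu; split=> //.
  by apply: contraNneq nQ => ->.
- move=> _; have [nQ cu] := Hb _ tA; rewrite cu; split=> //.
  by apply: contraNneq nQ => <-.
- by rewrite /step_QQ eqxx.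
Qed.

(** Such a pair was recoloured [K kappa] and admits no third point. Of three letters in the layer,
    two would be among the [z b], whose pair is not [c1]; the other special layers over [e] do not
    see [K kappa], as [kappa] is no side of the triangle [o]. *)
Lemma step_old_cliqueG e j x y c A : mono_on step_color (inl c) A ->
  inl (h e (Some j), x) \in A -> inl (h e (Some j), y) \in A -> x != y ->
  #|A| < k.
Proof.
move=> monoA xA yA nxy.
have cE u v : inl (h e (Some j), u) \in A -> inl (h e (Some j), v) \in A ->
    u != v -> [/\ c = K kappa, C0 u v = c1 & inQ u || inQ v].
  move=> uA vA nuv.
  have ne : inl (h e (Some j), u) != inl (h e (Some j), v) :> step_point.
    by apply: contraNneq nuv => -[->].
  have := monoA _ _ uA vA ne; rewrite /= /step_EE eqxx hG_isF hG_isG /=.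
  by case: (C0 u v =P c1) => //= ->; case: (_ || _) => // -[].
have [cK cxy Qxy] := cE _ _ xA yA nxy.
apply: (card_lt_of_pair (a := inl (h e (Some j), x)) (b := inl (h e (Some j), y))) => // s sA nx ny.
have := monoA _ _ sA xA nx; have := monoA _ _ sA yA ny; rewrite cK.
case: s sA nx ny => [[q v]|[[e' l]|[[e' j'] b]]] sA nx ny /=.
- have [eq|nq] := eqVneq q (h e (Some j)).
    move=> _ _; move: sA nx ny; rewrite eq => sA nx ny.
    have nvx : v != x by apply: contraNneq nx => ->.
    have nvy : v != y by apply: contraNneq ny => ->.
    have [_ cvx Qvx] := cE _ _ sA xA nvx; have [_ cvy Qvy] := cE _ _ sA yA nvy.
    case/orP: Qxy => [Qx|Qy].
      case/orP: Qvy => [Qv|Qy].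
        by have := inQ_c1 Qv Qx nvx; rewrite cvx eqxx.
      by have := inQ_c1 Qx Qy nxy; rewrite cxy eqxx.
    case/orP: Qvx => [Qv|Qx].
      by have := inQ_c1 Qv Qy nvy; rewrite cvy eqxx.
    by have := inQ_c1 Qx Qy nxy; rewrite cxy eqxx.
  have adj u : step_EE q v (h e (Some j)) u = inl (K kappa) ->
      (v == u) || inO v && inO u.
    move=> /old_EE[//|XK /or4P[->//|/strick_X|/strick_X|/and4P[-> -> _ _]]].
    - by rewrite XK => /esym/kappa_c1.
    - by rewrite X_sym XK => /esym/kappa_c1.
    - by rewrite orbT.
  move=> /adj Hy /adj Hx.
  have noQ u u' : inQ u -> u != u' -> (v == u) || inO v && inO u ->
      (v == u') || inO v && inO u' -> False.
    move=> Qu nu /orP[/eqP vu|/andP[_ /inO_inQ]]; last by rewrite Qu.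
    case/orP => [/eqP vu'|/andP[/inO_inQ]]; first by rewrite -vu vu' eqxx in nu.
    by rewrite vu Qu.
  case/orP: Qxy => Q; first exact: noQ Q nxy Hx Hy.
  by apply: noQ Q _ Hy Hx; rewrite eq_sym.
- move=> _; rewrite /step_VE hGF => -[]; have [->|ne] := eqVneq e' e.
    by rewrite X_Fg => /kappa_c1.
  exact: X_farF ne.
- move=> _; rewrite /step_QE hGF; case: ifP => // nq [].
  have [ee|ne] := eqVneq e' e; last exact: X_farF ne.
  move: nq; rewrite ee; have [->|nj] := eqVneq j' j; first by rewrite eqxx.
  rewrite X_near; last by apply: contraNneq nj => -[->].
  by move=> _ /K_inj/eqP; rewrite (negbTE (kappa2 nj)).
Qed.

Lemma step_free : clique_free k step_color.
Proof.
move=> [c|c] A monoA; last exact: step_new_clique monoA.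
have [/existsP[s /andP[sA /existsP[t /and3P[tA ne /eqP eb]]]]|] :=
    boolP [exists s in A, [exists t, [&& t \in A, s != t & base s == base t]]].
  have := monoA _ _ sA tA ne; move: sA tA ne eb.
  case: s t => [[p x]|[[e l]|[[e j] b]]] [[q y]|[[e' l']|[[e' j'] b']]] sA tA ne /=.
  - move=> epq; move: tA ne; rewrite -epq => tA ne.
    have nxy : x != y by apply: contraNneq ne => ->.
    rewrite /step_EE eqxx; case: (boolP (isF p)).
      case/existsP => e /eqP ep _; move: sA tA; rewrite ep => sA tA.
      exact: step_old_cliqueF monoA sA tA nxy.
    move=> _; case: ifP => // /and3P[/existsP[e /existsP[j /eqP ep]] _ _] _.
    move: sA tA; rewrite ep => sA tA.
    exact: step_old_cliqueG monoA sA tA nxy.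
  - by move=> ->; rewrite /step_VE eqxx.
  - by move=> ->; rewrite /step_QE eqxx.
  - by move=> <-; rewrite /step_VE eqxx.
  - by move=> /h_inj[-> _]; rewrite /step_VV eqxx.
  - by move=> /h_inj[].
  - by move=> <-; rewrite /step_QE eqxx.
  - by move=> /h_inj[].
  - by move=> /h_inj[-> _]; rewrite /step_QQ eqxx.
move=> /existsPn H; apply: (clique_free_map (phi := base) (c := c) X_free).
move=> s t sA tA ne; have nb : base s != base t.
  apply/negP => eb; have /negP := H s; apply; rewrite sA.
  by apply/existsP; exists t; rewrite tA ne.
by split=> //; apply: step_old_base nb _; apply: monoA.
Qed.

(* The special layers for the next level; in a layer [h e None], where the new
   colours have been replaced, the additional points take over. *)
Definition step_rep (p : TX) (i : option bool) : step_point :=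
  if [pick e | p == h e None] is Some e then inr (inl (e, exist _ (o i) (o_w i)))
  else inl (p, o i).

Lemma step_repP p i : (exists2 e, p = h e None &
      step_rep p i = inr (inl (e, exist _ (o i) (o_w i)))) \/
    ~~ isF p /\ step_rep p i = inl (p, o i).
Proof.
rewrite /step_rep; case: pickP => [e /eqP pe|npe]; first by left; exists e.
by right; split=> //; apply/existsPn => e; rewrite npe.
Qed.

Let o_inO i : inO (o i).
Proof. by apply/existsP; exists i. Qed.

Lemma step_rep_inj p q i j : step_rep p i = step_rep q j -> p = q /\ i = j.
Proof.
case: (step_repP p i) => [[e -> ->]|[_ ->]];
  case: (step_repP q j) => [[e' -> ->]|[_ ->]] //; by case=> -> /o_inj ->.
Qed.

Lemma step_rep_far p q i j c : p != q ->
  step_color (step_rep p i) (step_rep q j) != inr c.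
Proof.
move=> ne; apply/eqP; move: ne.
case: (step_repP p i) => [[e -> ->]|[Fp ->]];
  case: (step_repP q j) => [[e' -> ->]|[Fq ->]] /=.
- by rewrite /step_VV; case: (e =P e') => [->|//]; rewrite eqxx.
- by rewrite /step_VE eq_sym => /negbTE ->.
- by rewrite /step_VE => /negbTE ->.
- by rewrite /step_EE => /negbTE ->; rewrite !o_inO Fp Fq !orbT.
Qed.

Lemma step_rep_near p i j : i != j ->
  step_color (step_rep p i) (step_rep p j) = inr (C0 (o i) (o j)).
Proof.
move=> ne; case: (step_repP p i) => [[e ep ->]|[Fp ->]];
  case: (step_repP p j) => [[e' ep' ->]|[Fq ->]] /=.
- by move: ep'; rewrite ep => /h_inj[-> _]; rewrite /step_VV eqxx.
- by move: Fq; rewrite ep hF_isF.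
- by move: Fp; rewrite ep' hF_isF.
- by rewrite /step_EE eqxx (negbTE Fp) !inO_inQ // !andbF.
Qed.

(** Each [e] contributes [#|T0| - 1] copies of letters and four twins. *)
Lemma card_step_point : #|step_point| = #|TX| * #|T0| + #|Y| * (#|T0| + 3).
Proof.
rewrite !card_sum !card_prod card_sig !card_bool -mulnA -mulnDr.
have -> : #|[pred l | l != w]| = #|T0|.-1 by rewrite -(cardC1 w).
have : 0 < #|T0| by apply/card_gt0P; exists w.
by case: #|T0| => // n _; rewrite addSnnS.
Qed.

End Step.

(** * The Ramsey bound for a red clique against a non-red triangle *)

Lemma ramsey_triangle (T : finType) (red : rel T) (k : nat) (A : {set T}) :
  symmetric red -> 0 < k -> 'C(k.+1, 2) <= #|A| ->
  (exists2 B : {set T}, B \subset A & k <= #|B| /\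
     {in B &, forall x y, x != y -> red x y}) \/
  (exists x y w, [/\ [/\ x \in A, y \in A & w \in A], [/\ x != y, x != w & y != w]
     & [/\ ~~ red x y, ~~ red x w & ~~ red y w]]).
Proof.
move=> red_sym; elim: k A => [|[|k] IHk] A // _ leA.
  have /card_gt0P[x xA] : 0 < #|A| by [].
  left; exists [set x]; first by rewrite sub1set.
  by rewrite cards1; split=> // y y' /set1P -> /set1P ->; rewrite eqxx.
have /card_gt0P[v vA] : 0 < #|A| by apply: leq_trans leA; rewrite bin_gt0.
pose R := [set x in A :\ v | red v x]; pose B := [set x in A :\ v | ~~ red v x].
have cRB : #|A| = (#|R| + #|B|).+1.
  rewrite (cardsD1 v A) vA add1n; congr _.+1.
  rewrite -(cardsID [set x | red v x] (A :\ v)); congr (_ + _).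
    by apply: eq_card => x; rewrite !inE.
  by apply: eq_card => x; rewrite !inE andbC.
have [leR|ltR] := leqP 'C(k.+2, 2) #|R|.
  case: (IHk R isT leR) => [[D DR [kD Dred]]|[x [y [w [[xR yR wR] ne nred]]]]].
    have vD : v \notin D by apply/negP => /(subsetP DR); rewrite !inE eqxx.
    left; exists (v |: D).
      rewrite subUset sub1set vA; apply/subsetP => x /(subsetP DR).
      by rewrite !inE => /andP[/andP[]].
    rewrite cardsU1 vD; split; first by rewrite add1n ltnS.
    move=> x y /setU1P[->|xD] /setU1P[->|yD]; rewrite ?eqxx // => nxy.
    - by move/(subsetP DR): yD; rewrite !inE => /andP[].
    - by rewrite red_sym; move/(subsetP DR): xD; rewrite !inE => /andP[].
    - exact: Dred.
  right; exists x, y, w; split=> //.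
  by move: xR yR wR; rewrite !inE => /andP[/andP[_ ->] _] /andP[/andP[_ ->] _] /andP[/andP[_ ->] _].
(* Few red neighbours leave [k + 2] non-red ones: a non-red pair among them closes a triangle with
   [v], otherwise they are the red clique. *)
have leB : k.+2 <= #|B|.
  by move: leA; rewrite binS bin1 cRB; lia.
have [/existsP[x /andP[xB /existsP[y /and3P[yB nxy nred]]]]|] :=
    boolP [exists x in B, [exists y, [&& y \in B, x != y & ~~ red x y]]].
  right; exists v, x, y; move: xB yB; rewrite !inE.
  move=> /andP[/andP[nxv xA] nvx] /andP[/andP[nyv yA] nvy].
  by split=> //; split=> //; rewrite eq_sym.
move=> /existsPn H; left; exists B.
  by apply/subsetP => x; rewrite !inE => /andP[/andP[]].
split=> // x y xB yB nxy; apply: contraT => nred.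
move: (H x); rewrite xB /= => /existsPn /(_ y).
by rewrite yB nxy nred.
Qed.

(** Symmetric functions on arbitrary finite types replace functions on edges, so that products and
    sums of types can serve as points and palettes; diagonal values do not affect cliques. *)
Definition colorable (k n N : nat) := exists (T P : finType) (C : T -> T -> P),
  [/\ #|T| = N, #|P| = n, forall x y, C x y = C y x & clique_free k C].

(** * Iterating the extension *)

Section Growth.
Variables (k : nat) (T0 P0 : finType) (C0 : T0 -> T0 -> P0).
Hypotheses (k_gt2 : 2 < k) (C0_sym : forall x y, C0 x y = C0 y x)
  (C0_free : clique_free k C0).

(** With two colours the triangle must be monochromatic to leave one for [kappa], and six points
    suffice. With more colours, pigeonhole at [o1] gives the equal sides and a third colour
    remains. *)
Lemma isosceles_triple : (#|P0| == 2) && (5 < #|T0|) || (2 < #|P0|) && (#|P0|.+1 < #|T0|) ->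
  exists o1 o2 o3 kappa, [/\ [/\ o1 != o2, o1 != o3 & o2 != o3],
    C0 o1 o2 = C0 o1 o3 & [/\ kappa != C0 o1 o2 & kappa != C0 o2 o3]].
Proof.
case/orP => [/andP[/eqP P2 T6]|/andP[P3 ltP]].
  have /card_gt0P[o1 _] : 0 < #|T0| by apply: leq_trans T6.
  (* The diagonal value only names one of the two colours. *)
  pose c := C0 o1 o1.
  have other a b : a != c -> b != c -> a = b.
    have : #|[set x | x != c]| <= 1.
      by rewrite cardsE (eq_card (B := predC1 c)) ?cardC1 ?P2.
    by move/card_le1P => H na nb; have := H a; rewrite inE na => /(_ isT b); rewrite !inE nb => /esym/eqP.
  have red_sym : symmetric (fun x y => C0 x y == c) by move=> x y; rewrite C0_sym.
  have le6 : 'C(4, 2) <= #|[set: T0]| by rewrite cardsT.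
  have [[B _ [kB Bred]]|[x [y [w [_ [nxy nxw nyw] [cxy cxw cyw]]]]]] :=
      ramsey_triangle red_sym (isT : 0 < 3) le6.
  - have /card_gt2P[x [y [w [[xB yB wB] [nxy nyw nwx]]]]] : 2 < #|B| by exact: kB.
    have /card_gt0P[d] : 0 < #|predC1 c| by rewrite cardC1 P2.
    rewrite !inE => nd; exists x, y, w, d.
    have nxw : x != w by rewrite eq_sym.
    rewrite (eqP (Bred _ _ xB yB nxy)) (eqP (Bred _ _ xB wB nxw)) (eqP (Bred _ _ yB wB nyw)).
    by split.
  - exists x, y, w, c; rewrite (other _ _ cxw cxy); split=> //.
    by split; rewrite eq_sym.
have /card_gt0P[o1 _] : 0 < #|T0| by apply: leq_trans ltP.
have /dinjectivePn[o2 o2P [o3]] : ~~ dinjectiveb (C0 o1) (predC1 o1).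
  apply/negP => /dinjectiveP inj.
  have := card_in_image inj; rewrite cardC1 => eqc.
  have := max_card (mem [seq C0 o1 x | x in predC1 o1]); rewrite eqc.
  by case: #|T0| ltP => //= m; rewrite ltnS ltnNge => /negbTE ->.
rewrite !inE => /andP[n32 n31] c23.
have : 0 < #|~: [set C0 o1 o2; C0 o2 o3]|.
  rewrite -(ltn_add2l #|[set C0 o1 o2; C0 o2 o3]|) cardsC addn0.
  by apply: leq_ltn_trans P3; rewrite cards2; case: (_ != _).
case/card_gt0P => d; rewrite !inE negb_or => /andP[d1 d2].
by exists o1, o2, o3, d; split=> //; split; rewrite // eq_sym.
Qed.


(** Once the isosceles triangle is removed, at least ['C(k.+1, 2)] letters remain; they contain no
    [c1] clique of size [k], hence a triangle avoiding [c1]. *)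
Lemma growth_letters :
  (#|P0| == 2) || (2 < #|P0|) && (#|P0|.+1 < #|T0|) ->
  'C(k.+1, 2) + 3 <= #|T0| ->
  exists (o : option bool -> T0) (z : bool -> T0) w c1 kappa,
    [/\ [/\ injective o, injective z & forall i b, o i != z b],
        (forall i, o i != w) /\ (forall b, z b != w),
        [/\ forall j, C0 (o None) (o (Some j)) = c1,
            forall b b', b != b' -> C0 (z b) (z b') != c1 &
            forall b, C0 (z b) w != c1]
      & kappa != c1 /\
        forall j j', j != j' -> C0 (o (Some j)) (o (Some j')) != kappa].
Proof.
move=> P_ge T_ge.
have /isosceles_triple[o1 [o2 [o3 [kappa [[n12 n13 n23] c23 [nk1 nk2]]]]]] :
    (#|P0| == 2) && (5 < #|T0|) || (2 < #|P0|) && (#|P0|.+1 < #|T0|).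
  case/orP: P_ge => [->|->] /=; last by rewrite orbT.
  apply/orP; left; apply: leq_trans T_ge; rewrite -[6]/(3 + 3) leq_add2r.
  by apply: (@leq_bin2l 3 k.+1 2); apply: ltnW.
pose O := [set o1; o2; o3].
have leO : 'C(k.+1, 2) <= #|~: O|.
  rewrite -(leq_add2r 3); apply: leq_trans T_ge _.
  rewrite -(cardsC O) addnC leq_add2l /O -setUA cardsU1 cards2.
  by case: (_ \notin _) (_ != _) => -[].
have red_sym : symmetric (fun x y => C0 x y == C0 o1 o2) by move=> x y; rewrite C0_sym.
have [[B _ [kB Bred]]|] := ramsey_triangle red_sym (ltnW (ltnW k_gt2)) leO.
  have : #|B| < k.
    by apply: (C0_free (c := C0 o1 o2)) => x y xB yB nxy; apply/eqP; apply: Bred.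
  by rewrite ltnNge kB.
case=> [x [y [w [[xO yO wO] [nxy nxw nyw] [cxy cxw cyw]]]]].
exists (fun i => if i is Some j then if j then o2 else o3 else o1).
exists (fun b : bool => if b then x else y), w, (C0 o1 o2), kappa.
move: xO yO wO; rewrite !inE !negb_or -!andbA.
move=> /and3P[x1 x2 x3] /and3P[y1 y2 y3] /and3P[w1 w2 w3].
split; [split | split | split | split=> //].
- move=> [[|]|] [[|]|] // /eqP; rewrite ?(negbTE n12) ?(negbTE n13) ?(negbTE n23) //;
  by rewrite eq_sym ?(negbTE n12) ?(negbTE n13) ?(negbTE n23).
- by move=> [] [] // /eqP; rewrite ?(negbTE nxy) // eq_sym (negbTE nxy).
- by move=> [[|]|] [|]; rewrite eq_sym.
- by move=> [[|]|]; rewrite eq_sym.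
- by case.
- by case.
- by move=> [|] [|] // _; rewrite C0_sym.
- by case.
- by move=> [|] [|] // _; rewrite eq_sym // C0_sym.
Qed.

Section Iterate.
Variables (o : option bool -> T0) (z : bool -> T0) (w : T0) (c1 kappa : P0).
Hypotheses (o_inj : injective o) (z_inj : injective z)
  (o_z : forall i b, o i != z b) (o_w : forall i, o i != w)
  (z_w : forall b, z b != w)
  (C_o1 : forall j, C0 (o None) (o (Some j)) = c1)
  (C_zz : forall b b', b != b' -> C0 (z b) (z b') != c1)
  (C_zw : forall b, C0 (z b) w != c1) (kappa1 : kappa != c1)
  (kappa2 : forall j j', j != j' -> C0 (o (Some j)) (o (Some j')) != kappa).

(** The invariant of the iteration: [N] points, [n] colours and [M] triples of special layers
    satisfying the hypotheses of the extension. *)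
Definition growth_state (n N M : nat) := exists (TX PX Y : finType)
    (X : TX -> TX -> PX) (K : P0 -> PX) (h : Y -> option bool -> TX),
  [/\ [/\ #|TX| = N, #|PX| = n & #|Y| = M],
      (forall x y, X x y = X y x) /\ clique_free k X,
      injective K /\ (forall e e' i i', h e i = h e' i' -> e = e' /\ i = i') &
      (forall e e' i i' c, e != e' -> X (h e i) (h e' i') != K c) /\
      (forall e i i', i != i' -> X (h e i) (h e i') = K (C0 (o i) (o i')))].

Lemma growth_init : growth_state #|P0| #|T0| 1.
Proof.
exists T0, P0, unit, C0, id, (fun=> o).
split=> //; first by rewrite card_unit.
by split=> // -[] [] i i' /o_inj.
Qed.

(** Every old point indexes one special triple of the next level, so [N] becomes the new number of
    triples. *)
Lemma growth_step n N M : growth_state n N M ->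
  growth_state (n + #|P0|) (N * #|T0| + M * (#|T0| + 3)) N.
Proof.
case=> TX [PX [Y [X [K [h [[cT cP cY] [X_sym X_free] [K_inj h_inj] [X_far X_near]]]]]]].
exists (step_point w TX Y), (PX + P0)%type, TX.
exists (step_color C0 o z c1 kappa X K h), inr, (step_rep o_w h).
split.
- by split; rewrite ?card_step_point ?card_sum ?cT ?cP ?cY.
- split; first exact: step_color_sym.
  by apply: step_free.
- split; first by move=> ? ? [].
  by move=> e e' i i'; apply: step_rep_inj.
- split; first by move=> e e' i i' c; apply: step_rep_far.
  by move=> e i i'; apply: step_rep_near.
Qed.

End Iterate.

(** The pair [(a_t, a_(t-1))], started with [a_(-1) = 1] for the single triple [o]. *)
Fixpoint growth_seq (r t : nat) : nat * nat :=
  if t is t'.+1 then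
    let: (a, b) := growth_seq r t' in (a * r + b * (r + 3), a)
  else (r, 1).

Lemma colorable_growth t :
  (#|P0| == 2) || (2 < #|P0|) && (#|P0|.+1 < #|T0|) ->
  'C(k.+1, 2) + 3 <= #|T0| ->
  colorable k (t.+1 * #|P0|) (growth_seq #|T0| t).1.
Proof.
move=> P_ge T_ge.
have [o [z [w [c1 [kappa [[oi zi oz] [ow zw] [Co Czz Czw] [k1 k2]]]]]]] :=
  growth_letters P_ge T_ge.
have H : growth_state o (t.+1 * #|P0|) (growth_seq #|T0| t).1 (growth_seq #|T0| t).2.
  elim: t => [|t IHt] /=; first by rewrite mul1n; apply: growth_init.
  move: (growth_step oi zi oz ow zw Co Czz Czw k1 k2 IHt).
  by rewrite mulSn addnC; case: (growth_seq _ t).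
case: H => TX [PX [Y [X [K [h [[cT cP _] [X_sym X_free] _ _]]]]]].
by exists TX, PX, X; split.
Qed.

End Growth.

(** * Growth rate of the recurrence *)

Lemma expn_gap q M : 0 < q -> exists t, M * q ^ t < q.+1 ^ t.
Proof.
(* Bernoulli: [(q + 1)^t >= q^t + t q^(t-1)], and the last term is [M q^t] for [t = M q]. *)
move=> q0; exists (M * q).
suff H t : q ^ t + t * q ^ t.-1 <= q.+1 ^ t.
  case: M => [|M]; first by rewrite mul0n mul0n.
  apply: leq_trans (H _); rewrite -[X in _ < X + _]addn0.
  have qM : 0 < M.+1 * q by rewrite muln_gt0.
  rewrite -mulnA -expnS prednK // addn0 -[X in X < _]add0n ltn_add2r.
  by rewrite expn_gt0 q0.
elim: t => [|t IHt]; first by rewrite mul0n addn0.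
rewrite [q.+1 ^ _]expnS; apply: leq_trans (leq_mul (leqnn _) IHt).
case: t {IHt} => [|t]; first by rewrite /= !expn0 !expn1 mul1n !muln1; lia.
by rewrite /= !expnS; nia.
Qed.

(** With [s = r + 1], the next sum is [s (a + b) + 2 b], and [a <= (2 s + 1) b]; so [a + b] grows by
    a factor of at least [s + 1 / (s + 1)] per step. *)
Lemma growth_seq_large r : 0 < r -> exists t, r.+1 ^ t.+1 < (growth_seq r t).1.
Proof.
move=> r0; pose s := r.+1.
pose a t := (growth_seq r t).1; pose b t := (growth_seq r t).2.
have aS t : a t.+1 = a t * r + b t * (r + 3) by rewrite /a /b /=; case: (growth_seq r t).
have bS t : b t.+1 = a t by rewrite /a /b /=; case: (growth_seq r t).
have ba t : b t <= a t.
  by elim: t => [|t IHt] //; rewrite bS aS; nia.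
have ab t : a t <= (2 * s).+1 * b t.
  by case: t => [|t]; rewrite ?bS ?aS /s; [rewrite /a /b /=; lia | have := ba t; nia].
have low t : (s.+1 * s).+1 ^ t <= (a t + b t) * s.+1 ^ t.
  elim: t => [|t IHt]; first by rewrite !expn0 muln1 addn1.
  rewrite bS aS !expnS; apply: leq_trans (leq_mul (leqnn _) IHt) _.
  have H : (s.+1 * s).+1 * (a t + b t) <= (a t * r + b t * (r + 3) + a t) * s.+1.
    by have := ab t; rewrite /s; nia.
  by rewrite !mulnA leq_mul2r H orbT.
(* The factor [2 * s] pays for [a + b <= 2 a] and for the extra power of [s]. *)
have [|t Ht] := @expn_gap (s.+1 * s) (2 * s) _; first by rewrite muln_gt0.
exists t; rewrite -/s -/(a t).
have : 2 * s * (s.+1 * s) ^ t < 2 * a t * s.+1 ^ t.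
  apply: leq_trans Ht _; apply: leq_trans (low t) _.
  by rewrite leq_mul2r mul2n -addnn leq_add2l ba orbT.
rewrite expnMn [s.+1 ^ t * _]mulnC mulnA ltn_mul2r => /andP[_].
by rewrite -mulnA ltn_mul2l /= -expnS.
Qed.

(** * Colourings of differences *)

(** The bound [b <= a + S] keeps differences where [chi] is controlled; cliques are increasing lists
    of integers that may start anywhere. *)
Definition diff_clique (chi : nat -> nat) (S c : nat) : rel nat :=
  fun a b => (a < b <= a + S) && (chi (b - a) == c).

Definition diff_colorable (k n S : nat) := exists chi : nat -> nat,
  (forall x, 0 < x <= S -> chi x < n) /\
  (forall c s, pairwise (diff_clique chi S c) s -> size s < k).

Lemma diff_colorable0 k : 1 < k -> diff_colorable k 0 0.
Proof.
move=> k1; exists (fun=> 0); split=> [x|c [|a [|b s]] /=]; [lia|lia|lia|].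
by case/andP => /andP[]; rewrite /diff_clique; lia.
Qed.

Lemma diff_colorable1 k : 1 < k -> diff_colorable k 1 (k - 2).
Proof.
move=> k1; exists (fun=> 0); split=> // c [|a s] ps; first by apply: ltn_trans k1.
have uniq_as : uniq (a :: s).
  rewrite uniq_pairwise; apply: sub_pairwise ps => x y /andP[/andP[xy _] _].
  by rewrite /= neq_ltn xy.
have sub_iota : {subset a :: s <= iota a (k - 2).+1}.
  move=> x; rewrite inE mem_iota => /orP[/eqP ->|xs]; first by lia.
  by move: ps => /= /andP[/allP /(_ x xs)]; rewrite /diff_clique; lia.
apply: leq_ltn_trans (uniq_leq_size uniq_as sub_iota) _; rewrite size_iota; lia.
Qed.

Lemma sub_pairwise_map (T U : eqType) (e : rel T) (e' : rel U) (f : T -> U) s :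
  {in s &, forall a b, e a b -> e' (f a) (f b)} ->
  pairwise e s -> pairwise e' (map f s).
Proof.
move=> ef ps; rewrite pairwise_map.
by apply: (sub_in_pairwise (P := mem s)) ps => //; apply/allP.
Qed.

(* Differences are read in base [M = 2 S + 1]: a residue in [1, S] is coloured
   by the lower digit, any other residue by the rounded-up quotient. *)
Lemma diff_colorable_comp k n n' S S' :
  diff_colorable k n S -> diff_colorable k n' S' ->
  diff_colorable k (n + n') ((2 * S).+1 * S' + S).
Proof.
move=> [chi [chi_lt chi_free]] [chi' [chi'_lt chi'_free]].
pose M := (2 * S).+1; have M0 : 0 < M by []. have ME : M = (2 * S).+1 by [].
pose low x := 0 < x %% M <= S.
pose psi x := if low x then chi (x %% M) else n + chi' ((x + S) %/ M).
have up_le x : x <= M * S' + S -> (x + S) %/ M <= S'.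
  by move=> lex; rewrite -ltnS ltn_divLR //; lia.
have up_gt x : 0 < x -> ~~ low x -> 0 < (x + S) %/ M.
  rewrite divn_gt0 // /low; case: (ltnP x M) => [xM|]; last by lia.
  by rewrite modn_small //; lia.
exists psi; split=> [x /andP[x0 xle]|c [|m s] ps].
- rewrite /psi; case: ifP => [lx|/negbT nlx]; first by apply: ltn_addr; apply: chi_lt.
  by rewrite ltn_add2l; apply: chi'_lt; rewrite up_gt // up_le.
- exact: leq_ltn_trans (chi_free 0 [::] isT).
have m_le a : a \in m :: s -> m <= a.
  rewrite inE => /orP[/eqP -> //|aS].
  by move: ps => /= /andP[/allP /(_ a aS)]; rewrite /diff_clique; lia.
have m_rel a : a \in m :: s -> a = m \/
    [/\ 0 < a - m, a - m <= M * S' + S & psi (a - m) = c].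
  rewrite inE => /orP[/eqP ->|aS]; first by left.
  right; move: ps => /= /andP[/allP /(_ a aS)]; rewrite /diff_clique => /andP[? /eqP ?] _.
  by split=> //; lia.
have addres a b : m <= a -> a < b -> b - m = (a - m) + (b - a) by lia.
have [clt|cge] := ltnP c n.
  (* Measured from the minimum [m], all residues are at most [S]; as [S + S < M], they add without
     carry. *)
  suff : size [seq (a - m) %% M | a <- m :: s] < k by rewrite size_map.
  apply: (chi_free c); apply: sub_pairwise_map ps => a b aS bS.
  have lowc x : psi x = c -> low x /\ chi (x %% M) = c.
    by rewrite /psi; case: ifP => // _; lia.
  have res a' : a' \in m :: s -> (a' - m) %% M <= S.
    by move=> /m_rel[->|[_ _ /lowc[/andP[]]]]; rewrite ?subnn ?mod0n.
  have ra := res a aS; have rb := res b bS; have ma := m_le a aS.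
  case/andP => /andP[ab _] /eqP /lowc[/andP[r0 rS] cE].
  suff E : (b - m) %% M = (a - m) %% M + (b - a) %% M.
    by rewrite /diff_clique E addKn cE eqxx; lia.
  rewrite (addres a b) // -modnDm modn_small //; lia.
suff : size [seq (a - m + S) %/ M | a <- m :: s] < k by rewrite size_map.
apply: (chi'_free (c - n)); apply: sub_pairwise_map ps => a b aS bS.
have nlow x : 0 < x <= M * S' + S -> psi x = c -> ~~ low x /\ chi' ((x + S) %/ M) = c - n.
  move=> _; rewrite /psi; case: ifP => [/chi_lt + cE|_]; first by rewrite cE ltnNge cge.
  by move=> <-; rewrite addKn.
have res a' : a' \in m :: s -> ~~ low (a' - m).
  move=> /m_rel[->|[x0 xM E]]; first by rewrite subnn /low mod0n.
  by case: (nlow (a' - m)) => //; rewrite x0.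
have ra := res a aS; have rb := res b bS; have ma := m_le a aS.
case/andP => /andP[ab abM] /eqP E.
have [nl cE] : ~~ low (b - a) /\ chi' ((b - a + S) %/ M) = c - n.
  by apply: nlow E; lia.
have up1 : 0 < (b - a + S) %/ M by apply: up_gt => //; lia.
have upS : (b - a + S) %/ M <= S' by apply: up_le; lia.
(* Rounding up adds at most [S] to each number, so [M] times the defect of additivity is at most
   [2 * S < M] in absolute value, and the defect vanishes. *)
suff EE : (b - m + S) %/ M = (a - m + S) %/ M + (b - a + S) %/ M.
  by rewrite /diff_clique EE addKn cE eqxx; lia.
(* [x = M * ceil x - d] with [d <= S] for every [x] of high colour *)
have decomp x : ~~ low x -> exists2 d, d <= S & x + d = (x + S) %/ M * M.
  rewrite /low => nx; exists (S - (x + S) %% M); first by lia.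
  have := divn_eq (x + S) M.
  suff : (x + S) %% M <= S by lia.
  rewrite -modnDml; have := ltn_pmod x M0; move: nx; move: (x %% M) => y ny yM.
  have [->|y0] := posnP y; first by rewrite add0n modn_small //; lia.
  have yS : S < y by lia.
  have -> : y + S = (y - S.+1) + M by lia.
  by rewrite modnDr modn_small; lia.
have [da dS ea] := decomp _ ra; have [db dbS eb] := decomp _ rb.
have [dc dcS ec] := decomp _ nl.
move: ea eb ec; move: (_ %/ _) (_ %/ _) (_ %/ _) => ua ub uc ea eb ec.
have E2 : ua * M + uc * M + db = ub * M + (da + dc) by rewrite -ea -eb -ec; lia.
have : db <= S by []. have : da + dc <= 2 * S by lia.
nia.
Qed.

(** * Ramsey numbers *)

(** A pair takes the colour of [|x - y|], a sum of truncated differences; the default of [insubd]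
    can occur only on the diagonal. *)
Lemma diff_colorable_colorable k n S : 0 < n ->
  diff_colorable k n S -> colorable k n S.+1.
Proof.
move=> n0 [chi [chi_lt chi_free]].
pose dist (x y : 'I_S.+1) := (x - y) + (y - x).
exists 'I_S.+1, 'I_n, (fun x y => insubd (Ordinal n0) (chi (dist x y))).
split; rewrite ?card_ord //.
  by move=> x y; rewrite /dist addnC.
move=> c A monoA.
rewrite cardE -(size_map val); apply: (chi_free c).
have : pairwise ltn (map val (enum A)).
  rewrite -(sorted_pairwise ltn_trans); apply: (subseq_sorted ltn_trans (s2 := iota 0 S.+1)).
    by rewrite -val_enum_ord; apply: map_subseq; rewrite {1}/enum_mem -enumT; apply: filter_subseq.
  exact: iota_ltn_sorted.
set sA := map val (enum A); move=> ps; apply: (sub_in_pairwise (P := mem sA)) ps; last by apply/allP.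
move=> _ _ /mapP[x xA ->] /mapP[y yA ->].
rewrite !mem_enum in xA yA; rewrite /= => ltxy.
have nxy : x != y by apply: contraTneq ltxy => ->; rewrite ltnn.
have leyS : y - x <= S by have := ltn_ord y; lia.
rewrite /diff_clique ltxy -leq_subLR leyS /=.
have := monoA x y xA yA nxy; rewrite /dist (eqP (ltnW ltxy : x - y == 0)) add0n => <-.
by rewrite val_insubd chi_lt ?eqxx // subn_gt0 ltxy.
Qed.

Lemma colorable_lt_ramsey k n N : 1 < k -> 0 < n -> colorable k n N -> N < ramsey n k.
Proof.
move=> k1 n0 [T [P [C [cT cP C_sym C_free]]]].
rewrite /ramsey; case: ex_minnP => s /andP[_ /forallP Hs] _.
rewrite ltnNge; apply/negP => sN.
have lsT : s <= #|T| by rewrite cT.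
pose f (x : 'I_s) : T := enum_val (widen_ord lsT x).
have f_inj : injective f by move=> x y /enum_val_inj/(congr1 val)/= /val_inj.
pose g (p : P) : 'I_n := cast_ord cP (enum_rank p).
have g_inj : injective g by move=> p q /cast_ord_inj/enum_rank_inj.
(* An edge is an unordered set: its colour is read off some ordering of the ends, and [C_sym] makes
   the choice immaterial. *)
pose c := [ffun e : Kedge s => odflt (Ordinal n0)
  [pick p | [exists x, exists y, [&& val e == [set x; y], x != y & p == g (C (f x) (f y))]]]].
have cE (e : Kedge s) x y : val e = [set x; y] -> x != y -> c e = g (C (f x) (f y)).
  move=> ee nxy; rewrite ffunE; case: pickP => [p /existsP[x' /existsP[y' /and3P[/eqP ee' nxy' /eqP ->]]]|].
    have := ee'; rewrite ee => /setP E.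
    have := E x; have := E y; have := E x'; rewrite !inE !eqxx ?orbT /= => H1 H2 H3.
    case/esym/orP: H3 => /eqP xE; subst x.
      case/esym/orP: H2 => /eqP yE; subst y => //.
      by rewrite eqxx in nxy.
    case/esym/orP: H2 => /eqP yE; subst y => //; last by rewrite eqxx in nxy.
    by rewrite C_sym.
  by move/(_ (g (C (f x) (f y)))) => /existsP[]; exists x; apply/existsP; exists y; rewrite ee !eqxx nxy.
have /existsP[A /andP[/eqP cA /forallP monoA]] := Hs c.
(* Since [1 < k], the clique has an edge, which supplies its colour. *)
have /card_gt1P[x0 [y0 [x0A y0A n00]]] : 1 < #|A| by rewrite cA.
have edge x y : x \in A -> y \in A -> x != y -> C (f x) (f y) = C (f x0) (f y0).
  move=> xA yA nxy.
  have exy : #|[set x; y]| == 2 by rewrite cards2 nxy.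
  have e00 : #|[set x0; y0]| == 2 by rewrite cards2 n00.
  have /forallP/(_ (exist _ [set x0; y0] e00)) := monoA (exist _ [set x; y] exy).
  have sub u v : u \in A -> v \in A -> [set u; v] \subset A.
    by move=> uA vA; rewrite subUset !sub1set uA.
  rewrite /= !sub //= => /eqP.
  by rewrite (cE _ x y) // (cE _ x0 y0) // => /g_inj.
have : #|f @: A| < k.
  apply: (C_free (C (f x0) (f y0))) => _ _ /imsetP[x xA ->] /imsetP[y yA ->] nf.
  by apply: edge => //; apply: contraNneq nf => ->.
by rewrite card_imset // cA ltnn.
Qed.

Lemma ramsey_colorable k n : 0 < k -> 0 < n -> colorable k n (ramsey n k).-1.
Proof.
move=> k0 n0; set s := (ramsey n k).-1.
(* Minimality of [ramsey] concerns positive orders, so [s = 0] is settled by the empty colouring. *)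
have [s_eq0|s_gt0] := posnP s.
  exists 'I_s, 'I_n, (fun _ _ => Ordinal n0); split; rewrite ?card_ord // => c A _.
  by apply: leq_ltn_trans (max_card _) _; rewrite card_ord s_eq0.
have : ~~ arrows n k s.
  apply/negP => Hs; have : ramsey n k <= s.
    by rewrite /ramsey; case: ex_minnP => r _; apply; rewrite s_gt0.
  by rewrite /s; move: s_gt0; rewrite /s; case: ramsey => //= m _; rewrite ltnn.
case/forallPn => c /existsPn cA.
pose C (x y : 'I_s) := if insub [set x; y] is Some e then c e else Ordinal n0.
exists 'I_s, 'I_n, C; split; rewrite ?card_ord //; first by move=> x y; rewrite /C setUC.
move=> d A monoA.
rewrite ltnNge; apply/negP => /card_geqP[t [ut st tA]].
have /negP := cA [set x in t]; apply.
rewrite cardsE (card_uniqP ut) st eqxx /=.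
have cd (e : Kedge s) : val e \subset [set x in t] -> c e = d.
  move=> eA; have /cards2P[x [y [nxy exy]]] : #|val e| == 2 := valP e.
  have memA u : u \in val e -> u \in A.
    by move=> /(subsetP eA); rewrite inE => /tA.
  rewrite -(monoA x y) ?memA ?exy ?inE ?eqxx ?orbT //.
  by rewrite /C -exy valK.
apply/forallP => e; apply/forallP => f.
by apply/implyP => /cd ->; apply/implyP => /cd ->.
Qed.

Lemma ramsey_gt0 n k : 0 < ramsey n k.
Proof. by rewrite /ramsey; case: ex_minnP => s /andP[]. Qed.

Lemma ramsey_prednK n k : (ramsey n k).-1.+1 = ramsey n k.
Proof. by rewrite prednK // ramsey_gt0. Qed.

Lemma ramsey1_le k : 0 < k -> ramsey 1 k <= k.
Proof.
move=> k0; rewrite /ramsey; case: ex_minnP => s _; apply; rewrite k0 /=.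
apply/forallP => c; apply/existsP; exists setT; rewrite cardsT card_ord eqxx.
by apply/forallP => e; apply/forallP => f; rewrite !ord1 eqxx !implybT.
Qed.

Lemma ramsey23_le : ramsey 2 3 <= 6.
Proof.
have [T [P [C [cT cP C_sym C_free]]]] := @ramsey_colorable 3 2 isT isT.
rewrite -ramsey_prednK ltnS -cT leqNgt; apply/negP => T6.
have /card_gt0P[p _] : 0 < #|P| by rewrite cP.
have other a b : a != p -> b != p -> a = b.
  have : #|[set x | x != p]| <= 1.
    by rewrite cardsE (eq_card (B := predC1 p)) ?cardC1 ?cP.
  move/card_le1P => H na nb; have := H a; rewrite inE na => /(_ isT b).
  by rewrite !inE nb => /esym/eqP.
have red_sym : symmetric (fun x y => C x y == p) by move=> x y; rewrite C_sym.
have le6 : 'C(4, 2) <= #|[set: T]| by rewrite cardsT.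
have [[B _ [kB Bred]]|[x [y [w [_ [nxy nxw nyw] [cxy cxw cyw]]]]]] :=
    ramsey_triangle red_sym (isT : 0 < 3) le6.
  have : #|B| < 3 by apply: (C_free p) => x y xB yB nxy; apply/eqP; apply: Bred.
  by rewrite ltnNge kB.
have : #|[set x; y; w]| < 3.
  apply: (C_free (C x y)) => u v.
  rewrite !inE -!orbA => /or3P[] /eqP -> /or3P[] /eqP ->; rewrite ?eqxx // => _;
    by apply: other; rewrite // C_sym.
by rewrite -setUA cardsU1 cards2 !inE negb_or nxy nxw nyw.
Qed.

(** Composition multiplies [2 S + 1], because [2 ((2 S + 1) S' + S) + 1 = (2 S + 1) (2 S' + 1)]. *)
Lemma diff_colorable_exp k n S t : 1 < k -> diff_colorable k n S ->
  exists2 St, diff_colorable k (t * n) St & (2 * St).+1 = (2 * S).+1 ^ t.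
Proof.
move=> k1 H; elim: t => [|t [St HSt eSt]].
  by exists 0; [rewrite mul0n; apply: diff_colorable0|].
exists ((2 * S).+1 * St + S); first by rewrite mulSn; apply: diff_colorable_comp.
by rewrite expnS -eSt; lia.
Qed.

(** The [t]-fold composition gives about half of [(2 S + 1)^t] points; for large [t] the strict
    inequality absorbs the lost factor [2^n0]. *)
Lemma diff_colorable_gap k n S n0 : 1 < k -> 0 < n -> diff_colorable k n S ->
  ramsey n0 k ^ n < (2 * S).+1 ^ n0 ->
  exists2 m, 0 < m & ramsey n0 k ^ m < (ramsey m k).-1 ^ n0.
Proof.
move=> k1 n_gt0 H; set a := ramsey n0 k ^ n => ltab.
have a0 : 0 < a by rewrite expn_gt0 ramsey_gt0.
have [t Ht] := expn_gap (2 ^ n0) a0.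
have t0 : 0 < t.
  by case: t Ht => //; rewrite !expn0 muln1 ltnNge expn_gt0.
have [St HSt eSt] := diff_colorable_exp t k1 H.
have m0 : 0 < t * n by rewrite muln_gt0 t0.
exists (t * n) => //.
have ltS : St < (ramsey (t * n) k).-1.
  by rewrite -ltnS ramsey_prednK; apply: colorable_lt_ramsey => //; apply: diff_colorable_colorable.
rewrite [t * n]mulnC expnM -/a mulnC; move: ltS; move: (_.-1) => r ltS.
rewrite -(ltn_pmul2l (m := 2 ^ n0)) ?expn_gt0 //; apply: leq_trans Ht _.
apply: (@leq_trans (((2 * S).+1 ^ n0) ^ t)); first by rewrite leq_exp2r.
rewrite -expnM [n0 * t]mulnC expnM -eSt -expnMn leq_exp2r //; last by case: (n0) ltab; rewrite ?expn0 //; lia.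
by lia.
Qed.

(** A partition of [[1, 44]] into four sum-free classes, 44 being the fourth Schur number: a
    monochromatic triangle would give [x + y = z] in one class. *)
Lemma schur44 : diff_colorable 3 4 44.
Proof.
pose A := [:: 1; 3; 5; 15; 17; 19; 26; 28; 40; 42; 44].
pose B := [:: 2; 7; 8; 18; 21; 24; 27; 33; 37; 38; 43].
pose C := [:: 4; 6; 13; 20; 22; 23; 25; 30; 32; 39; 41].
pose chi x := if x \in A then 0 else if x \in B then 1 else if x \in C then 2 else 3.
exists chi; split=> [x _|c [|a1 [|a2 [|a3 s]]] //=].
  by rewrite /chi; do 3!case: ifP => // _.
have free : all (fun x => all (fun y => (x + y <= 44) ==>
    ~~ ((chi x == chi (x + y)) && (chi y == chi (x + y)))) (iota 1 44)) (iota 1 44).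
  by vm_compute.
rewrite /diff_clique => /andP[/and3P[/andP[/andP[lt12 le12] /eqP c12] /andP[/andP[lt13 le13] /eqP c13] _]].
case/andP=> /andP[/andP[/andP[lt23 le23] /eqP c23] _] _.
have x1 : a2 - a1 \in iota 1 44 by rewrite mem_iota; lia.
have x2 : a3 - a2 \in iota 1 44 by rewrite mem_iota; lia.
have := allP (allP free _ x1) _ x2.
have -> : a2 - a1 + (a3 - a2) = a3 - a1 by lia.
by rewrite c12 c13 c23 eqxx /= implybF; lia.
Qed.

(** The integer form of [R_n0(k)^(1/n0) < r_m^(1/m)]. *)
Lemma ramsey_growth k n0 : 2 < k -> 0 < n0 ->
  exists2 m, 0 < m & ramsey n0 k ^ m < (ramsey m k).-1 ^ n0.
Proof.
move=> k2 n0_gt0; have k1 := ltnW k2.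
have [n0_1|n0_2] := leqP n0 1.
  have -> : n0 = 1 by lia.
  (* As [R_1(k) <= k], the bound [2 k - 3] suffices for [k >= 4]; for [k = 3], [3^4 < 89]. *)
  have [k4|k3] := leqP 4 k.
    apply: diff_colorable_gap (diff_colorable1 k1) _ => //.
    by rewrite !expn1; apply: leq_ltn_trans (ramsey1_le (ltnW k1)) _; lia.
  have -> : k = 3 by lia.
  apply: diff_colorable_gap schur44 _ => //; rewrite expn1.
  by apply: (@leq_ltn_trans (3 ^ 4)); rewrite ?leq_exp2r // ramsey1_le.
(* Here [r <= 5] is too small for the extension, but [6^4 < 89^2]. *)
have [/andP[/eqP n2 /eqP k3]|nex] := boolP ((n0 == 2) && (k == 3)).
  rewrite n2 k3; apply: diff_colorable_gap schur44 _ => //.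
  by apply: (@leq_ltn_trans (6 ^ 4)); rewrite ?leq_exp2r // ramsey23_le.
(* Iterating the one-colour case gives [2 S + 1 = (2 k - 3)^n0] with [S < r], which ensures enough
   letters. *)
have [S HS eS] := diff_colorable_exp n0 k1 (diff_colorable1 k1).
have ltS : S < (ramsey n0 k).-1.
  rewrite -ltnS ramsey_prednK; apply: colorable_lt_ramsey => //.
  by apply: diff_colorable_colorable => //; rewrite -[n0]muln1.
have [T [P [C [cT cP C_sym C_free]]]] := ramsey_colorable (ltnW k1) n0_gt0.
move: ltS cT; set r := (ramsey n0 k).-1 => ltS cT.
have pow_le a : a <= 2 * k - 3 -> a ^ n0 <= (2 * S).+1.
  move=> ak; rewrite eS; have -> : (2 * (k - 2)).+1 = 2 * k - 3 by lia.
  by rewrite leq_exp2r.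
have P_ge : (#|P| == 2) || (2 < #|P|) && (#|P|.+1 < #|T|).
  rewrite cP cT; have [//|n2] := eqVneq n0 2.
  have n3 : 2 < n0 by lia.
  rewrite n3 /=; have := pow_le 3; suff : 2 * n0 + 3 <= 3 ^ n0 by lia.
  rewrite -(subnK (ltnW n3)) !addn2; elim: (n0 - 2) => // m; rewrite [3 ^ m.+3]expnS; lia.
have T_ge : 'C(k.+1, 2) + 3 <= #|T|.
  have C2 : 2 * 'C(k.+1, 2) <= k.+1 * k.
    by rewrite bin2 /= mul2n -[leqRHS]odd_double_half leq_addl.
  rewrite cT; have [k4|k3] := leqP 4 k.
    suff : (2 * k - 3) ^ 2 <= (2 * S).+1 by nia.
    apply: leq_trans (pow_le _ (leqnn _)); rewrite leq_exp2l //; lia.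
  have k3E : k = 3 by lia.
  have : 3 ^ 3 <= (2 * S).+1.
    apply: leq_trans (pow_le 3 _); last by rewrite k3E.
    by rewrite leq_exp2l //; move: nex; rewrite k3E andbT; lia.
  have -> : 'C(k.+1, 2) = 6 by rewrite k3E.
  by lia.
have r0 : 0 < r by lia.
have [t Ht] := growth_seq_large r0.
have m0 : 0 < t.+1 * n0 by rewrite muln_gt0.
exists (t.+1 * n0) => //.
have := colorable_growth k2 C_sym C_free t P_ge T_ge.
rewrite cT cP => /(colorable_lt_ramsey k1 m0).
rewrite -ramsey_prednK ltnS => /(leq_trans Ht) lt.
by rewrite -(ramsey_prednK n0 k) -/r expnM ltn_exp2r.
Qed.

(** * Independent sets in graph powers *)

Lemma colorable_mul k m n M N :
  colorable k m M -> colorable k n N -> colorable k (m + n) (M * N).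
Proof.
move=> [S [P [C [cS cP C_sym C_free]]]] [T [Q [D [cT cQ D_sym D_free]]]].
pose E (s t : S * T) : P + Q :=
  if s.1 == t.1 then inr (D s.2 t.2) else inl (C s.1 t.1).
exists (S * T)%type, (P + Q)%type, E; split.
- by rewrite card_prod cS cT.
- by rewrite card_sum cP cQ.
- by move=> s t; rewrite /E eq_sym C_sym D_sym.
move=> [c|d] A monoA.
  apply: (clique_free_map (phi := fst) (c := c) C_free) => s t sA tA ne.
  by have := monoA s t sA tA ne; rewrite /E; case: eqP => // _ [].
apply: (clique_free_map (phi := snd) (c := d) D_free) => s t sA tA ne.
have := monoA s t sA tA ne; rewrite /E; case: eqP => // e1 [->]; split=> //.
by apply: contraNneq ne => e2; rewrite [s]surjective_pairing [t]surjective_pairing e1 e2.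
Qed.

Lemma independentP (G : sgraph) (A : {set G}) :
  reflect {in A &, forall x y, ~~ adj x y} (independent A).
Proof.
apply: (iffP forall_inP) => [H x y xA yA|H x xA].
  by have /forall_inP := H x xA; apply.
by apply/forall_inP => y; apply: H.
Qed.

Lemma leq_alpha (G : sgraph) (A : {set G}) : independent A -> #|A| <= alpha G.
Proof. by move=> iA; apply: (@leq_bigmax_cond _ _ (fun A : {set G} => #|A|)). Qed.

Lemma alpha_witness (G : sgraph) : exists2 A : {set G}, independent A & #|A| = alpha G.
Proof.
have i0 : independent (set0 : {set G}) by apply/independentP => x y; rewrite inE.
have /(eq_bigmax_cond (fun A : {set G} => #|A|))[A iA eA] : 0 < #|[pred A | @independent G A]|.
  by apply/card_gt0P; exists set0.
by exists A.
Qed.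

Lemma prod_adjPn n (G : 'I_n -> sgraph) (u v : graph_prod G) :
  reflect (exists i, (u i != v i) && ~~ adj (u i) (v i)) ((u != v) && ~~ adj u v).
Proof.
rewrite /adj /= /prod_adj negb_and; apply: (iffP idP) => [/andP[-> /= /forallPn[i]]|[i /andP[ne na]]].
  by rewrite negb_or => H; exists i.
have nuv : u != v by apply: contraNneq ne => ->.
rewrite nuv /=; apply/forallPn; exists i; by rewrite negb_or ne.
Qed.

(** A clique of colour [i] projects injectively in coordinate [i] onto an independent set of [G]. *)
Lemma colorable_alpha (G : sgraph) (k n : nat) : 0 < n -> alpha G < k ->
  colorable k n (alpha (graph_pow G n)).
Proof.
move=> n0 ltG; have [A /independentP iA <-] := alpha_witness (graph_pow G n).
pose far (u v : graph_pow G n) i := (u i != v i) && ~~ adj (u i) (v i).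
pose C (u v : {u | u \in A}) : 'I_n :=
  odflt (Ordinal n0) [pick i | far (val u) (val v) i].
exists {u | u \in A}, 'I_n, C; split.
- by rewrite card_sig; apply: eq_card => u; rewrite !inE.
- exact: card_ord.
- move=> u v; congr odflt; apply: eq_pick => i.
  by rewrite /far eq_sym adj_sym.
move=> i B monoB.
have farB u v : u \in B -> v \in B -> u != v -> far (val u) (val v) i.
  move=> uB vB ne; have := monoB u v uB vB ne; rewrite /C; case: pickP => [j fj /= <- //|none].
  have /prod_adjPn[j fj] : (val u != val v) && ~~ adj (val u) (val v).
    by rewrite iA ?(valP u) ?(valP v) // andbT; apply: contraNneq ne => /val_inj ->.
  by move: (none j); rewrite /far fj.
pose phi (u : {u | u \in A}) : G := val u i.
have phi_inj : {in B &, injective phi}.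
  move=> u v uB vB e; apply/eqP/negP => /negP /(farB u v uB vB).
  by rewrite /far /phi in e *; rewrite e eqxx.
rewrite -(card_in_imset phi_inj); apply: leq_ltn_trans ltG; apply: leq_alpha.
apply/independentP => _ _ /imsetP[u uB ->] /imsetP[v vB ->].
have [->|ne] := eqVneq u v; first by rewrite adj_irrefl.
by have /andP[] := farB u v uB vB ne.
Qed.

(** Words are concatenated; two results are separated in a coordinate of a half where they
    differ. *)
Lemma alpha_pow_mul (G : sgraph) (m n : nat) :
  alpha (graph_pow G m) * alpha (graph_pow G n) <= alpha (graph_pow G (m + n)).
Proof.
have [A /independentP iA <-] := alpha_witness (graph_pow G m).
have [B /independentP iB <-] := alpha_witness (graph_pow G n).
pose F (p : graph_pow G m * graph_pow G n) : graph_pow G (m + n) :=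
  [ffun i => match split i with inl a => p.1 a | inr b => p.2 b end].
have Fl p a : F p (lshift n a) = p.1 a by rewrite ffunE (unsplitK (inl a)).
have Fr p b : F p (rshift m b) = p.2 b by rewrite ffunE (unsplitK (inr b)).
have F_inj : injective F.
  move=> [u v] [u' v'] e; congr pair; apply/ffunP => i.
    by have := congr1 (fun f : graph_pow G (m + n) => f (lshift n i)) e; rewrite !Fl.
  by have := congr1 (fun f : graph_pow G (m + n) => f (rshift m i)) e; rewrite !Fr.
rewrite -cardsX -(card_imset _ F_inj); apply: leq_alpha; apply/independentP.
move=> _ _ /imsetP[[u v] uv ->] /imsetP[[u' v'] uv' ->].
have [->|ne] := eqVneq (u, v) (u', v'); first by rewrite adj_irrefl.
case/setXP: uv => uA vB; case/setXP: uv' => uA' vB'.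
suff /prod_adjPn/andP[] : exists i, (F (u, v) i != F (u', v') i) && ~~ adj (F (u, v) i) (F (u', v') i) by [].
have [eu|nu] := eqVneq u u'.
  have nv : v != v' by apply: contraNneq ne => ->; rewrite eu.
  have /prod_adjPn[i Hi] : (v != v') && ~~ adj v v' by rewrite nv iB.
  by exists (rshift m i); rewrite !Fr.
have /prod_adjPn[i Hi] : (u != u') && ~~ adj u u' by rewrite nu iA.
by exists (lshift n i); rewrite !Fl.
Qed.

(** * The graph of a colouring *)

Section ColorGraph.
Variables (k : nat) (T P : finType) (C : T -> T -> P).
Hypotheses (C_sym : forall x y, C x y = C y x) (C_free : clique_free k C).

Definition color_adj (u v : P * T + 'I_k.-1) : bool :=
  match u, v with
  | inl (p, x), inl (q, y) => (p != q) || (x != y) && (C x y != p)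
  | inr _, inr _ => false
  | _, _ => true
  end.

Lemma color_adj_sym : symmetric color_adj.
Proof.
move=> [[p x]|i] [[q y]|j] //=; rewrite eq_sym; case: eqP => //= ->.
by rewrite eq_sym C_sym.
Qed.

Lemma color_adj_irrefl : irreflexive color_adj.
Proof. by move=> [[p x]|i] //=; rewrite !eqxx. Qed.

(* The join of the complements of the colour classes; the edgeless part on
   [k - 1] vertices makes the independence number exactly [k - 1]. *)
Definition color_graph := SGraph color_adj_sym color_adj_irrefl.

(** Different parts of the join are completely adjacent, so an independent set is a clique of one
    colour or lies in the edgeless part. *)
Lemma alpha_color_graph : 0 < k -> alpha color_graph = k - 1.
Proof.
move=> k0; apply/eqP; rewrite eqn_leq subn1; apply/andP; split.
  apply/bigmax_leqP => A /independentP iA; rewrite -ltnS prednK //.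
  have [->|[u uA]] := set_0Vmem A; first by rewrite cards0.
  case: u uA => [[p x0]|i0] uA.
    pose phi (v : color_graph) : T := if v is inl (_, x) then x else x0.
    apply: (clique_free_map (phi := phi) (c := p) C_free) => s t sA tA ne.
    have mem (v : color_graph) : v \in A -> exists x, v = inl (p, x).
      move=> vA; have := iA _ _ uA vA; case: v vA => [[q x]|j] //= vA.
      by rewrite negb_or negbK => /andP[/eqP -> _]; exists x.
    have [x es] := mem _ sA; have [y et] := mem _ tA; move: ne (iA _ _ sA tA).
    rewrite es et /= eqxx /= => ne; have nxy : x != y by apply: contraNneq ne => ->.
    by rewrite nxy negbK => /eqP.
  have sub : A \subset [set inr i | i : 'I_k.-1].
    apply/subsetP => v vA; have := iA _ _ uA vA.
    by case: v vA => [[q x]|j] //= _ _; apply: imset_f.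
  apply: leq_ltn_trans (subset_leq_card sub) _.
  by rewrite card_imset ?card_ord ?prednK // => i j [].
have inr_inj : injective (fun i : 'I_k.-1 => inr i : color_graph) by move=> i j [].
rewrite -[leqLHS]card_ord -cardsT -(card_imset _ inr_inj).
by apply: leq_alpha; apply/independentP => _ _ /imsetP[i _ ->] /imsetP[j _ ->].
Qed.

(** The diagonal words of distinct [x] and [y] are separated in the coordinate of the colour
    [C x y]. *)
Lemma alpha_color_graph_pow : 0 < #|P| -> #|T| <= alpha (graph_pow color_graph #|P|).
Proof.
move=> P0; pose F (x : T) : graph_pow color_graph #|P| :=
  [ffun i => inl (enum_val i, x)].
have FE x i : F x i = inl (enum_val i, x) by rewrite ffunE.
have F_inj : injective F.
  by move=> x y e; have := FE y (Ordinal P0); rewrite -e FE => -[].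
rewrite -cardsT -(card_imset _ F_inj); apply: leq_alpha; apply/independentP.
move=> _ _ /imsetP[x _ ->] /imsetP[y _ ->].
have [->|ne] := eqVneq x y; first by rewrite adj_irrefl.
suff /prod_adjPn/andP[] : exists i, (F x i != F y i) && ~~ adj (F x i) (F y i) by [].
exists (enum_rank (C x y)); rewrite !FE /= enum_rankK !eqxx ne /= andbT.
by apply: contraNneq ne => -[->].
Qed.

End ColorGraph.

Lemma ramsey_pred_gt0 k n : 1 < k -> 0 < n -> 0 < (ramsey n k).-1.
Proof.
move=> k1 n0; rewrite -ltnS ramsey_prednK; apply: colorable_lt_ramsey => //.
exists 'I_1, 'I_n, (fun _ _ => Ordinal n0); split; rewrite ?card_ord // => c A _.
by apply: leq_ltn_trans (max_card _) _; rewrite card_ord.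
Qed.

Lemma ramsey_pred_mul k m n : 1 < k -> 0 < m -> 0 < n ->
  (ramsey m k).-1 * (ramsey n k).-1 <= (ramsey (m + n) k).-1.
Proof.
move=> k1 m0 n0; rewrite -ltnS ramsey_prednK; have k0 := ltnW k1.
apply: colorable_lt_ramsey; rewrite ?addn_gt0 ?m0 //.
by apply: colorable_mul; apply: ramsey_colorable.
Qed.

Lemma alpha_pow_gt0 (G : sgraph) n : 0 < alpha G -> 0 < alpha (graph_pow G n).
Proof.
have [A _ <-] := alpha_witness G => /card_gt0P[x _].
pose u : graph_pow G n := [ffun=> x].
rewrite -(cards1 u); apply: leq_alpha; apply/independentP.
by move=> _ _ /set1P -> /set1P ->; rewrite adj_irrefl.
Qed.

From mathcomp Require Import all_order all_algebra ring.
From mathcomp Require Import all_classical all_reals all_analysis.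

(** * Limits of n-th roots *)

Section NthRoot.
Import Order.TTheory GRing.Theory Num.Theory numFieldNormedType.Exports.
Import Defs.
Local Open Scope classical_set_scope.
Local Open Scope ring_scope.

Variable R : realType.

Lemma nthroot_ge0 n a : 0 <= nthroot R n a.
Proof. exact: powR_ge0. Qed.

Lemma nthrootK n a : (0 < n)%N -> nthroot R n a ^+ n = a%:R.
Proof.
move=> n0; rewrite /nthroot -powR_mulrn ?powR_ge0 // -powRrM mulVf ?powRr1 //.
by rewrite pnatr_eq0 -lt0n.
Qed.

Lemma ltr_nthroot m n a b : (0 < m)%N -> (0 < n)%N -> (a ^ m < b ^ n)%N ->
  nthroot R n a < nthroot R m b.
Proof.
move=> m0 n0 lt_ab; rewrite -(@ltr_pXn2r _ (n * m)) ?nnegrE ?nthroot_ge0 ?muln_gt0 ?n0 //.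
by rewrite exprM nthrootK // mulnC exprM nthrootK // -!natrX ltr_nat.
Qed.

Lemma ler_nthroot n a b : (a <= b)%N -> nthroot R n a <= nthroot R n b.
Proof.
by move=> le_ab; rewrite /nthroot ge0_ler_powR ?nnegrE ?invr_ge0 ?ler0n ?ler_nat.
Qed.

Lemma cvg_powRr (c y : R) (f : nat -> R) : 0 < c ->
  f @ \oo --> y -> (fun n => c `^ f n) @ \oo --> c `^ y.
Proof.
move=> c0 fy; rewrite {2}/powR gt_eqF //.
have -> : (fun n => c `^ f n) = (fun n => expR (f n * ln c)).
  by apply/funext => n; rewrite /powR gt_eqF.
apply: (@cvg_comp _ _ _ (fun n => f n * ln c) expR); last exact: continuous_expR.
exact: cvgMl.
Qed.

Lemma cvg_invn : (fun n : nat => n%:R^-1 : R) @ \oo --> (0 : R).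
Proof. by rewrite -cvg_shiftS; apply: cvg_harmonic. Qed.

(** Fekete's lemma in multiplicative form, with a possibly infinite limit. Since [2^(1/n)] tends to
    1, [b] may be [R_n(k)] while [a] is [R_n(k) - 1]. *)
Lemma nthroot_fekete (a b : nat -> nat) :
  (forall n, (0 < n)%N -> (0 < a n)%N) ->
  (forall m n, (0 < m)%N -> (0 < n)%N -> (a m * a n <= a (m + n))%N) ->
  (forall n, (0 < n)%N -> (a n <= b n <= 2 * a n)%N) ->
  (fun n => (nthroot R n (b n))%:E) @ \oo -->
    ereal_sup [set (nthroot R m (a m))%:E | m in [set m | (0 < m)%N]].
Proof.
move=> a_gt0 a_mul ab; set A := [set _ | _ in _].
have a_exp m q : (0 < m)%N -> (0 < q)%N -> (a m ^ q <= a (q * m))%N.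
  move=> m0; elim: q => // -[|q] IHq _; first by rewrite expn1 mul1n.
  rewrite expnS mulSn; apply: leq_trans (a_mul _ _ _ _); rewrite ?muln_gt0 //.
  by rewrite leq_mul2l IHq ?orbT.
(* With [q = n %/ m], [a m ^ q <= a n] and [q / n >= 1 / m - 1 / n]. *)
have lower m n : (0 < m)%N -> (m <= n)%N ->
    (a m)%:R `^ (m%:R^-1 - n%:R^-1) <= nthroot R n (b n).
  move=> m0 mn; have n0 := leq_trans m0 mn.
  have a1 : 1 <= (a m)%:R :> R by rewrite ler1n a_gt0.
  have q0 : (0 < n %/ m)%N by rewrite divn_gt0.
  have leab : (a m ^ (n %/ m) <= b n)%N.
    have /andP[anb _] := ab n n0; apply: leq_trans anb.
    apply: leq_trans (a_exp _ _ m0 q0) _; rewrite {2}(divn_eq n m).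
    have [->|s0] := posnP (n %% m); first by rewrite addn0.
    apply: leq_trans (a_mul _ _ _ s0); last by rewrite muln_gt0 q0.
    by rewrite leq_pmulr ?a_gt0.
  apply: le_trans (ler_nthroot n leab); rewrite /nthroot natrX -powR_mulrn ?ler0n // -powRrM.
  rewrite ler_powR // -(@ler_pM2r _ (n%:R * m%:R)); last by rewrite mulr_gt0 ?ltr0n.
  have nn : n%:R != 0 :> R by rewrite pnatr_eq0 -lt0n.
  have mn0 : m%:R != 0 :> R by rewrite pnatr_eq0 -lt0n.
  have -> : (m%:R^-1 - n%:R^-1) * (n%:R * m%:R) = n%:R - m%:R :> R.
    by field; rewrite nn mn0.
  have -> : (n %/ m)%:R * n%:R^-1 * (n%:R * m%:R) = (n %/ m)%:R * m%:R :> R.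
    by field.
  rewrite lerBlDr -natrM -natrD ler_nat.
  by rewrite {1}(divn_eq n m) leq_add2l ltnW // ltn_pmod.
have upper n : (0 < n)%N ->
    ((nthroot R n (b n))%:E <= (2 `^ (n%:R^-1))%:E * ereal_sup A)%E.
  move=> n0; have /andP[_ b2a] := ab n n0.
  apply: (@le_trans _ _ ((2 `^ n%:R^-1)%:E * (nthroot R n (a n))%:E)%E).
    rewrite -EFinM lee_fin; apply: le_trans (ler_nthroot n b2a) _.
    by rewrite /nthroot natrM powRM ?ler0n.
  rewrite lee_pmul2l // ?lte_fin ?powR_gt0 //.
  by apply: ereal_sup_ubound; exists n.
have large (x : R) : (x%:E < ereal_sup A)%E ->
    \forall n \near \oo, x < nthroot R n (b n).
  move=> /ereal_sup_gt[_ [m m0 <-]]; rewrite lte_fin => xm.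
  have am0 : 0 < (a m)%:R :> R by rewrite ltr0n a_gt0.
  have cv : (fun n : nat => (a m)%:R `^ (m%:R^-1 - n%:R^-1)) @ \oo --> nthroot R m (a m).
    apply: cvg_powRr => //; rewrite -[X in _ --> X]subr0.
    by apply: cvgB; [exact: cvg_cst|exact: cvg_invn].
  near=> n; apply: lt_le_trans (lower m n m0 _); last by near: n; exists m.
  by near: n; apply: (cvgr_gt _ cv).
have supA_gt0 : (0 < ereal_sup A)%E.
  apply: (@lt_le_trans _ _ (nthroot R 1 (a 1%N))%:E); last by apply: ereal_sup_ubound; exists 1%N.
  by rewrite lte_fin powR_gt0 // ltr0n a_gt0.
case E : (ereal_sup A) => [l| |].
- rewrite E in upper large; apply: cvg_EFin; first by near=> n.
  apply/cvgrPdist_lt => e e0.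
  have l0 : 0 < l by rewrite E lte_fin in supA_gt0.
  have cv : (fun n : nat => 2 `^ n%:R^-1 * l) @ \oo --> (2 : R) `^ 0 * l.
    by apply: cvgMl; apply: cvg_powRr; [rewrite ltr0n|exact: cvg_invn].
  rewrite powRr0 mul1r in cv.
  near=> n; rewrite ltr_distlC /=; apply/andP; split.
    by near: n; apply: large; rewrite lte_fin; rewrite ltrBlDr ltrDl.
  apply: (@le_lt_trans _ _ (2 `^ n%:R^-1 * l)).
    by rewrite -lee_fin EFinM; apply: upper; near: n; exists 1%N.
  by near: n; apply: (cvgr_lt _ cv); rewrite ltrDl.
- apply/cvgeyPgt => x; near=> n.
  by rewrite lte_fin; near: n; apply: large; rewrite E ltry.
- by rewrite E in supA_gt0.
Unshelve. all: by end_near.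
Qed.

End NthRoot.

(** * Lower bounds for the Ramsey limit and the Shannon supremum *)

Section Limits.
Import Order.TTheory GRing.Theory Num.Theory numFieldNormedType.Exports.
Import Defs.
Local Open Scope classical_set_scope.
Local Open Scope ring_scope.
Variable R : realType.

Lemma nthroot_le_ramsey_lim k m : (1 < k)%N -> (0 < m)%N ->
  ((nthroot R m (ramsey m k).-1)%:E <= ramsey_lim R k)%E.
Proof.
move=> k1 m0; have cv := @nthroot_fekete R (fun n => (ramsey n k).-1) (ramsey^~ k).
rewrite /ramsey_lim (cvg_lim _ (cv _ _ _)) //.
- by apply: ereal_sup_ubound; exists m.
- by move=> n; apply: ramsey_pred_gt0.
- by move=> p q; apply: ramsey_pred_mul.
(* [R_n(k) >= 2] gives [R_n(k) <= 2 (R_n(k) - 1)]. *)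
- move=> n n0; have := ramsey_pred_gt0 k1 n0.
  by case: (ramsey n k) => // r /= r0; rewrite leqnSn mul2n -addnn -ltnS ltnS -add1n leq_add2r.
Qed.

(** The capacity is a limit in [R], so the supremum of Fekete's lemma must be finite; it is at most
    [#|G|]. *)
Lemma nthroot_le_shannon (G : sgraph) m : (0 < alpha G)%N -> (0 < m)%N ->
  nthroot R m (alpha (graph_pow G m)) <= shannon_capacity R G.
Proof.
move=> G0 m0; pose a n := alpha (graph_pow G n).
have a0 n : (0 < n)%N -> (0 < a n)%N by move=> _; apply: alpha_pow_gt0.
have cv : (fun n => (nthroot R n (a n))%:E) @ \oo -->
    ereal_sup [set (nthroot R m (a m))%:E | m in [set m | (0 < m)%N]].
  apply: nthroot_fekete => // [p q _ _|n _]; first exact: alpha_pow_mul.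
  by rewrite leqnn mul2n -addnn leq_addr.
set l := ereal_sup _ in cv.
have ub : ((nthroot R m (a m))%:E <= l)%E by apply: ereal_sup_ubound; exists m.
have lb : (l <= #|G|%:R%:E)%E.
  apply: ge_ereal_sup => _ [n /= n0 <-]; rewrite lee_fin.
  rewrite -(@ler_pXn2r _ n) ?nnegrE ?nthroot_ge0 ?ler0n // nthrootK // -natrX ler_nat.
  rewrite /a; have [A _ <-] := alpha_witness (graph_pow G n).
  apply: leq_trans (max_card _) _.
  by rewrite card_ffun card_ord.
have fin_l : l \is a fin_num.
  by rewrite fin_numE; case: (l) ub lb.
move: cv; rewrite -(fineK fin_l) => /fine_cvg cv.
rewrite /shannon_capacity (cvg_lim _ cv) //.
by rewrite -lee_fin fineK.
Qed.

Lemma nthroot_le_shannon_sup k m : (1 < k)%N -> (0 < m)%N ->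
  ((nthroot R m (ramsey m k).-1)%:E <= shannon_sup R k)%E.
Proof.
move=> k1 m0; have k0 := ltnW k1.
have [T [P [C [cT cP C_sym C_free]]]] := ramsey_colorable k0 m0.
have G_alpha := alpha_color_graph C_sym C_free k0.
have G0 : (0 < alpha (color_graph k C_sym))%N by rewrite G_alpha subn_gt0.
apply: (@le_trans _ _ (shannon_capacity R (color_graph k C_sym))%:E); last first.
  by apply: ereal_sup_ubound; exists (color_graph k C_sym).
rewrite lee_fin; apply: le_trans (nthroot_le_shannon G0 m0); apply: ler_nthroot.
have := @alpha_color_graph_pow k _ _ _ C_sym; rewrite cT cP; exact.
Qed.

End Limits.

Theorem theorem4 (R : realType) (k : nat) (hk : (3 <= k)%N) :
  (forall n0 : nat, (0 < n0)%N ->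
     ((nthroot R n0 (ramsey n0 k))%:E < ramsey_lim R k)%E)
  /\
  (forall G : sgraph, alpha G = (k - 1)%N ->
     forall n : nat, (0 < n)%N ->
       ((nthroot R n (alpha (graph_pow G n)))%:E < shannon_sup R k)%E).
Proof.
have k1 := ltnW hk; split=> [n n_gt0|G Gk n n_gt0].
  have [m m_gt0 lt_m] := ramsey_growth hk n_gt0.
  apply: Order.POrderTheory.lt_le_trans (nthroot_le_ramsey_lim R k1 m_gt0).
  by rewrite lte_fin ltr_nthroot.
have [m m_gt0 lt_m] := ramsey_growth hk n_gt0.
apply: Order.POrderTheory.lt_le_trans (nthroot_le_shannon_sup R k1 m_gt0).
(* An independent set of the power carries a colouring, so its size is below [ramsey n k] and the
   same [m] works. *)
rewrite lte_fin ltr_nthroot //; apply: leq_ltn_trans lt_m.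
rewrite leq_exp2r // ltnW //; apply: colorable_lt_ramsey => //.
by apply: colorable_alpha => //; rewrite Gk subn1 prednK // ltnW // ltnW.
Qed.
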